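(* Let $0<q<1$ and let $a,b,c,d,r$ be complex numbers with $c\neq0$, $r\neq0$ and $\max\{|a|,|b|,|c|,|d|,|abr/c|\}<1$. Then \[ \int_0^\pi\frac{h(\cos2\theta;1)}{h(\cos\theta;a,b,c,d)}\; {}_3\phi_2\!\left({ce^{i\theta},\ ce^{-i\theta},\ c/r\atop ac,\ bc};q,\ \frac{abr}{c}\right)d\theta =\frac{2\pi\,(abdr;q)_\infty}{(q,\,ac,\,ad,\,bc,\,bd,\,cd,\,abr/c;q)_\infty}. \]
   Context: $(a;q)_n=\prod_{k=0}^{n-1}(1-aq^k)$, $(a;q)_\infty=\prod_{k\ge0}(1-aq^k)$, $(a_1,\dots,a_m;q)_n=\prod_i(a_i;q)_n$. ${}_3\phi_2\!\left({a_1,a_2,a_3\atop b_1,b_2};q,z\right)=\sum_{n\ge0}\frac{(a_1,a_2,a_3;q)_n}{(q,b_1,b_2;q)_n}z^n$. For $x=\cos\theta$: $h(x;a)=(ae^{i\theta},ae^{-i\theta};q)_\infty=\prod_{k\ge0}(1-2q^kax+q^{2k}a^2)$, and $h(x;a_1,\dots,a_m)=h(x;a_1)\cdots h(x;a_m)$. Thus $h(\cos2\theta;1)=(e^{2i\theta},e^{-2i\theta};q)_\infty$. *)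

(* Defs.v *)
From Stdlib Require Import Reals Lra ClassicalEpsilon.
Open Scope R_scope.

Record Cplx := mkC { Re : R; Im : R }.
Definition RtoC (x : R) : Cplx := mkC x 0.
Definition Czero : Cplx := RtoC 0.
Definition Cone : Cplx := RtoC 1.
Definition Cadd (z w : Cplx) : Cplx := mkC (Re z + Re w) (Im z + Im w).
Definition Copp (z : Cplx) : Cplx := mkC (- Re z) (- Im z).
Definition Csub (z w : Cplx) : Cplx := Cadd z (Copp w).
Definition Cmul (z w : Cplx) : Cplx :=
  mkC (Re z * Re w - Im z * Im w) (Re z * Im w + Im z * Re w).
Definition Cinv (z : Cplx) : Cplx :=
  let n := Re z * Re z + Im z * Im z in mkC (Re z / n) (- Im z / n).
Definition Cdiv (z w : Cplx) : Cplx := Cmul z (Cinv w).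
Definition Cnorm (z : Cplx) : R := sqrt (Re z * Re z + Im z * Im z).
Definition Cscal (x : R) (z : Cplx) : Cplx := mkC (x * Re z) (x * Im z).
Definition Cexpi (t : R) : Cplx := mkC (cos t) (sin t).
Fixpoint Cpow (z : Cplx) (n : nat) : Cplx :=
  match n with O => Cone | S m => Cmul z (Cpow z m) end.

Definition Cseq_cv (u : nat -> Cplx) (l : Cplx) : Prop :=
  Un_cv (fun n => Re (u n)) (Re l) /\ Un_cv (fun n => Im (u n)) (Im l).
Definition Clim (u : nat -> Cplx) : Cplx :=
  epsilon (inhabits Czero) (fun l => Cseq_cv u l).

Fixpoint qpoch (a : Cplx) (q : R) (n : nat) : Cplx :=
  match n with
  | O => Cone
  | S m => Cmul (qpoch a q m) (Csub Cone (Cscal (q ^ m) a))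
  end.
Definition qpoch_inf (a : Cplx) (q : R) : Cplx := Clim (qpoch a q).

Fixpoint h_part (x : R) (a : Cplx) (q : R) (n : nat) : Cplx :=
  match n with
  | O => Cone
  | S m => Cmul (h_part x a q m)
      (Cadd (Csub Cone (Cscal (2 * q ^ m * x) a)) (Cscal (q ^ (2 * m)) (Cmul a a)))
  end.
Definition h (x : R) (a : Cplx) (q : R) : Cplx := Clim (h_part x a q).

Definition phi32_term (a1 a2 a3 b1 b2 : Cplx) (q : R) (z : Cplx) (n : nat) : Cplx :=
  Cdiv (Cmul (Cmul (Cmul (qpoch a1 q n) (qpoch a2 q n)) (qpoch a3 q n)) (Cpow z n))
       (Cmul (Cmul (qpoch (RtoC q) q n) (qpoch b1 q n)) (qpoch b2 q n)).
Fixpoint phi32_part (a1 a2 a3 b1 b2 : Cplx) (q : R) (z : Cplx) (N : nat) : Cplx :=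
  match N with
  | O => Czero
  | S m => Cadd (phi32_part a1 a2 a3 b1 b2 q z m) (phi32_term a1 a2 a3 b1 b2 q z m)
  end.
Definition phi32 (a1 a2 a3 b1 b2 : Cplx) (q : R) (z : Cplx) : Cplx :=
  Clim (phi32_part a1 a2 a3 b1 b2 q z).

(** Riemann integral (Stdlib RiemannInt), with a classically chosen
    integrability witness; 0 if not integrable. *)
Definition RInt (f : R -> R) (lo hi : R) : R :=
  match excluded_middle_informative (inhabited (Riemann_integrable f lo hi)) with
  | left H =>
      RiemannInt (proj1_sig (constructive_indefinite_description
                   (fun _ : Riemann_integrable f lo hi => True)
                   (match H with inhabits x => ex_intro _ x I end)))
  | right _ => 0
  end.
Definition CInt (f : R -> Cplx) (lo hi : R) : Cplx :=
  mkC (RInt (fun t => Re (f t)) lo hi) (RInt (fun t => Im (f t)) lo hi).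
Definition C_integrable (f : R -> Cplx) (lo hi : R) : Prop :=
  inhabited (Riemann_integrable (fun t => Re (f t)) lo hi) /\
  inhabited (Riemann_integrable (fun t => Im (f t)) lo hi).

(* Main.v *)
(** Since [(c e^(it), c e^(-it); q)_n / h(x; c) = 1 / h(x; c q^n)], integrating the series term by
    term yields Askey-Wilson integrals with parameters [a, b, c q^n, d], and the resulting sum is
    Gauss's [2phi1(c/r, cd; abcd; q, abr/c)].

    The Askey-Wilson integral [I(a, b, c, d)] follows from the contiguous relation
    [(1-ab)(1-ac)(1-ad) I(a, b, c, d) = (1-abcd) I(qa, b, c, d)]: iterating it in each parameter
    reduces the evaluation to [I(0, 0, 0, 0)], which is found from the case
    [(q, -q, sqrt q, -sqrt q)], where the integrand is [4 (sin t)^2].  The relation is equivalent to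
    the value of the first moment [int w (z + 1/z)], obtained by shifting a contour from [|z| = 1] to
    [|z| = q]; Cauchy's theorem is replaced by uniform approximation by Laurent polynomials on
    both circles.  The q-Gauss sum is iterated in the same way, from a telescoping relation
    between [S(z)] and [S(qz)]. *)
Require Import Defs.
From Stdlib Require Import Reals Lra Lia ClassicalEpsilon.
From Coquelicot Require Coquelicot.
Open Scope R_scope.

Module AskeyWilson.
Import Coquelicot.Coquelicot.
Local Open Scope C_scope.
Local Open Scope R_scope.

(** The annulus [q <= |z| <= 1] may contain poles of the weight, at [z = a] and its companions, so
    shifting the contour of the weight itself would produce residues. [contour] carries factors that
    cancel these poles, and its values at [z] and at [qz] are the same weight times two rational
    functions whose difference is linear in [z + 1/z]; this is how the first moment enters. A
    Laurent monomial has the same integral in [t] over every circle centred at 0, so uniform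
    approximation on the two boundary circles alone equates the two integrals of [contour]. Its
    factors can be approximated because they are uniform limits of finite products and geometric
    series.

    Sending a parameter to 0 requires no general continuity in the parameter: along
    [a, qa, q^2 a, ...] the weight is the original one times finite products, and these converge
    uniformly. The recurrences are kept multiplied out, so that they can be iterated without
    dividing. *)

(** * Uniform convergence and limits of complex sequences *)

Definition unif_cv {T : Type} (D : T -> Prop) (f : nat -> T -> C) (g : T -> C) : Prop :=
  forall eps : R, 0 < eps -> exists N, forall n, (N <= n)%nat ->
  forall x, D x -> Cmod (f n x - g x)%C < eps.
Definition bounded_on {T : Type} (D : T -> Prop) (g : T -> C) : Prop :=
  exists M : R, forall x, D x -> Cmod (g x) <= M.
Definition bounded_away {T : Type} (D : T -> Prop) (g : T -> C) : Prop :=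
  exists m : R, 0 < m /\ forall x, D x -> m <= Cmod (g x).
Definition ccv (u : nat -> C) (l : C) : Prop :=
  forall eps : R, 0 < eps -> exists N, forall n, (N <= n)%nat -> Cmod (u n - l)%C < eps.

Lemma bounded_on_pos {T} (D : T -> Prop) g :
  bounded_on D g -> exists M, 0 < M /\ forall x, D x -> Cmod (g x) <= M.
Proof.
  intros [M HM]. exists (Rmax M 1). split.
  - pose proof (Rmax_r M 1); lra.
  - intros x Hx. apply Rle_trans with M; auto using Rmax_l.
Qed.

Lemma bounded_on_const {T} (D : T -> Prop) c : bounded_on D (fun _ => c).
Proof. exists (Cmod c); intros; lra. Qed.

Lemma bounded_on_mult {T} (D : T -> Prop) f g : bounded_on D f -> bounded_on D g -> bounded_on D (fun x => f x * g x)%C.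
Proof.
  intros Hf Hg. destruct (bounded_on_pos _ _ Hf) as [M [M0 HM]], (bounded_on_pos _ _ Hg) as [N [N0 HN]].
  exists (M * N). intros x Hx. rewrite Cmod_mult.
  apply Rmult_le_compat; auto using Cmod_ge_0.
Qed.

Lemma bounded_on_inv {T} (D : T -> Prop) g : bounded_away D g -> bounded_on D (fun x => / g x)%C.
Proof.
  intros [m [m0 Hm]]. exists (/ m). intros x Hx. specialize (Hm x Hx).
  rewrite Cmod_inv.
  - apply Rinv_le_contravar; auto.
  - apply Cmod_gt_0. lra.
Qed.

Lemma bounded_away_mult {T} (D : T -> Prop) f g : bounded_away D f -> bounded_away D g -> bounded_away D (fun x => f x * g x)%C.
Proof.
  intros [m [m0 Hm]] [n [n0 Hn]]. exists (m * n). split.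
  - apply Rmult_lt_0_compat; auto.
  - intros x Hx. rewrite Cmod_mult. apply Rmult_le_compat; auto; lra.
Qed.

Lemma bounded_away_neq {T} (D : T -> Prop) g x : bounded_away D g -> D x -> g x <> RtoC 0.
Proof. intros [m [m0 Hm]] Hx. apply Cmod_gt_0. specialize (Hm x Hx). lra. Qed.

Lemma unif_cv_const {T} (D : T -> Prop) g : unif_cv D (fun _ => g) g.
Proof.
  intros eps He. exists 0%nat. intros n _ x _.
  replace (g x - g x)%C with (RtoC 0) by ring. rewrite Cmod_0. exact He.
Qed.

Lemma unif_cv_mult {T} (D : T -> Prop) f1 g1 f2 g2 :
  unif_cv D f1 g1 -> unif_cv D f2 g2 -> bounded_on D g1 -> bounded_on D g2 ->
  unif_cv D (fun n x => f1 n x * f2 n x)%C (fun x => g1 x * g2 x)%C.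
Proof.
  intros H1 H2 B1 B2.
  destruct (bounded_on_pos _ _ B1) as [M1 [M10 HM1]], (bounded_on_pos _ _ B2) as [M2 [M20 HM2]].
  intros eps He.
  (* With both errors below [e <= 1], the error of the product is at most [e * e + e * (M1 + M2) <=
     e * (M1 + M2 + 1)]. *)
  set (e := Rmin 1 (eps / (M1 + M2 + 1))).
  assert (Hq : 0 < eps / (M1 + M2 + 1)) by (apply Rdiv_lt_0_compat; lra).
  assert (He0 : 0 < e) by (unfold e; apply Rmin_pos; lra).
  assert (He1 : e <= 1) by apply Rmin_l.
  assert (He2 : e * (M1 + M2 + 1) <= eps).
  { assert (e <= eps / (M1 + M2 + 1)) by apply Rmin_r.
    apply Rle_trans with (eps / (M1 + M2 + 1) * (M1 + M2 + 1)).
    - apply Rmult_le_compat_r; lra.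
    - right. field. lra. }
  destruct (H1 e He0) as [N1 HN1], (H2 e He0) as [N2 HN2].
  exists (max N1 N2). intros n Hn x Hx.
  specialize (HN1 n ltac:(lia) x Hx). specialize (HN2 n ltac:(lia) x Hx).
  specialize (HM1 x Hx). specialize (HM2 x Hx).
  replace (f1 n x * f2 n x - g1 x * g2 x)%C with
    ((f1 n x - g1 x) * (f2 n x - g2 x) + (g1 x * (f2 n x - g2 x) + g2 x * (f1 n x - g1 x)))%C by ring.
  eapply Rle_lt_trans; [apply Cmod_triangle|].
  eapply Rle_lt_trans; [apply Rplus_le_compat_l, Cmod_triangle|].
  rewrite !Cmod_mult.
  pose proof (Cmod_ge_0 (f1 n x - g1 x)). pose proof (Cmod_ge_0 (f2 n x - g2 x)).
  pose proof (Cmod_ge_0 (g1 x)). pose proof (Cmod_ge_0 (g2 x)).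
  nra.
Qed.

Lemma unif_cv_inv {T} (D : T -> Prop) f g :
  unif_cv D f g -> bounded_away D g -> unif_cv D (fun n x => / f n x)%C (fun x => / g x)%C.
Proof.
  intros H [m [m0 Hm]] eps He.
  (* The first bound keeps [|f n x| >= m / 2]; the second then makes the error, at most
     [e / (m / 2 * m)], no larger than [eps / 2]. *)
  set (e := Rmin (m / 2) (eps * (m * m) / 4)).
  assert (He0 : 0 < e) by (apply Rmin_pos; [lra | apply Rdiv_lt_0_compat; [|lra]; repeat apply Rmult_lt_0_compat; auto]).
  assert (He1 : e <= m / 2) by apply Rmin_l.
  assert (He2 : e <= eps * (m * m) / 4) by apply Rmin_r.
  destruct (H e He0) as [N HN]. exists N. intros n Hn x Hx.
  specialize (HN n Hn x Hx). specialize (Hm x Hx).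
  assert (Hf : m / 2 <= Cmod (f n x)).
  { assert (Cmod (g x) <= Cmod (f n x) + Cmod (f n x - g x)); [|lra].
    replace (g x) with (f n x + - (f n x - g x))%C at 1 by ring.
    eapply Rle_trans; [apply Cmod_triangle|]. rewrite Cmod_opp. lra. }
  assert (f n x <> RtoC 0) by (apply Cmod_gt_0; lra).
  assert (g x <> RtoC 0) by (apply Cmod_gt_0; lra).
  replace (/ f n x - / g x)%C with (- (f n x - g x) * / (f n x * g x))%C by (field; auto).
  rewrite Cmod_mult, Cmod_opp, Cmod_inv, Cmod_mult by (apply Cmult_neq_0; auto).
  assert (Hp : m / 2 * m <= Cmod (f n x) * Cmod (g x)) by (apply Rmult_le_compat; lra).
  apply Rlt_le_trans with (e * / (Cmod (f n x) * Cmod (g x))).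
  - apply Rmult_lt_compat_r; auto. apply Rinv_0_lt_compat. nra.
  - apply Rle_trans with (e * / (m / 2 * m)).
    + apply Rmult_le_compat_l; [lra|]. apply Rinv_le_contravar; auto. nra.
    + apply Rle_trans with (eps * (m * m) / 4 * / (m / 2 * m)).
      * apply Rmult_le_compat_r; auto. left; apply Rinv_0_lt_compat; nra.
      * replace (eps * (m * m) / 4 * / (m / 2 * m)) with (eps / 2) by (field; lra). lra.
Qed.

(** Seen as uniform convergence over a one-point set, convergence of sequences inherits the product
    rule. *)
Lemma ccv_unif_cv u l : ccv u l <-> unif_cv (fun _ : unit => True) (fun n _ => u n) (fun _ => l).
Proof.
  split; intros H eps He; destruct (H eps He) as [N HN]; exists N; intros; auto.
  apply (HN n H0 tt I).
Qed.

Lemma ccv_const l : ccv (fun _ => l) l.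
Proof. apply ccv_unif_cv, (unif_cv_const (T := unit) _ (fun _ => l)). Qed.

Lemma ccv_mult u v l m : ccv u l -> ccv v m -> ccv (fun n => u n * v n)%C (l * m)%C.
Proof.
  rewrite !ccv_unif_cv. intros H1 H2.
  apply (unif_cv_mult _ _ (fun _ => l) _ (fun _ => m)); auto using bounded_on_const.
Qed.

Lemma ccv_plus u v l m : ccv u l -> ccv v m -> ccv (fun n => u n + v n)%C (l + m)%C.
Proof.
  intros H1 H2 eps He. destruct (H1 (eps / 2) ltac:(lra)) as [N1 HN1].
  destruct (H2 (eps / 2) ltac:(lra)) as [N2 HN2].
  exists (max N1 N2). intros n Hn.
  specialize (HN1 n ltac:(lia)). specialize (HN2 n ltac:(lia)).
  replace (u n + v n - (l + m))%C with ((u n - l) + (v n - m))%C by ring.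
  eapply Rle_lt_trans; [apply Cmod_triangle|]. lra.
Qed.

Lemma ccv_ext u v l : (forall n, u n = v n) -> ccv u l -> ccv v l.
Proof.
  intros E H eps He. destruct (H eps He) as [N HN]. exists N.
  intros n Hn. rewrite <- E. auto.
Qed.

Lemma ccv_unique u l m : ccv u l -> ccv u m -> l = m.
Proof.
  intros H1 H2. cut (Cmod (l - m) <= 0).
  { intros H. assert (E : (l - m)%C = RtoC 0).
    { apply Cmod_eq_0. pose proof (Cmod_ge_0 (l - m)). lra. }
    replace l with (l - m + m)%C by ring. rewrite E. ring. }
  apply le_epsilon. intros eps He.
  destruct (H1 (eps / 2) ltac:(lra)) as [N1 HN1].
  destruct (H2 (eps / 2) ltac:(lra)) as [N2 HN2].
  specialize (HN1 (max N1 N2) ltac:(lia)). specialize (HN2 (max N1 N2) ltac:(lia)).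
  set (w := u (max N1 N2)) in *.
  replace (l - m)%C with (- (w - l) + (w - m))%C by ring.
  eapply Rle_trans; [apply Cmod_triangle|]. rewrite Cmod_opp. lra.
Qed.

Lemma ccv_incr u l k : ccv u l -> ccv (fun n => u (n + k)%nat) l.
Proof.
  intros H eps He. destruct (H eps He) as [N HN]. exists N.
  intros n Hn. apply HN. lia.
Qed.

Lemma ccv_squeeze u l (v : nat -> R) :
  (forall n, Cmod (u n - l)%C <= v n) -> is_lim_seq v 0 -> ccv u l.
Proof.
  intros H Hv eps He. apply is_lim_seq_spec in Hv.
  destruct (Hv (mkposreal eps He)) as [N HN]. exists N. intros n Hn.
  specialize (HN n Hn). simpl in HN. rewrite Rminus_0_r in HN.
  eapply Rle_lt_trans; [apply H|]. eapply Rle_lt_trans; [apply Rle_abs|]. exact HN.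
Qed.

Lemma is_lim_seq_geom_scal K q : 0 <= q < 1 -> is_lim_seq (fun n => K * q ^ n) 0.
Proof.
  intros Hq. replace (Finite 0) with (Rbar_mult K 0) by (simpl; f_equal; ring).
  apply is_lim_seq_scal_l. apply is_lim_seq_geom. rewrite Rabs_pos_eq; lra.
Qed.

Fixpoint csum (f : nat -> C) (n : nat) : C :=
  match n with O => RtoC 0 | S m => (csum f m + f m)%C end.

(** [Lim_seq] is total, so this denotes a limit only where convergence is known; [clim_unique] makes
    the link. *)
Definition clim (u : nat -> C) : C :=
  (real (Lim_seq (fun n => fst (u n))), real (Lim_seq (fun n => snd (u n)))).

Lemma Cmod_le_sum (z : C) : Cmod z <= Rabs (fst z) + Rabs (snd z).
Proof.
  assert (E : z = (RtoC (fst z) + Ci * RtoC (snd z))%C)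
    by (apply injective_projections; simpl; ring).
  rewrite E at 1. eapply Rle_trans; [apply Cmod_triangle|].
  rewrite Cmod_mult, Cmod_Ci, !Cmod_R. lra.
Qed.

Lemma Rabs_fst_le_Cmod (z : C) : Rabs (fst z) <= Cmod z.
Proof. eapply Rle_trans; [apply Rmax_l | apply Rmax_Cmod]. Qed.

Lemma Rabs_snd_le_Cmod (z : C) : Rabs (snd z) <= Cmod z.
Proof. eapply Rle_trans; [apply Rmax_r | apply Rmax_Cmod]. Qed.

Lemma is_lim_seq_ccv (u : nat -> C) (l : C) :
  is_lim_seq (fun n => fst (u n)) (fst l) -> is_lim_seq (fun n => snd (u n)) (snd l) -> ccv u l.
Proof.
  intros H1 H2 eps He. apply is_lim_seq_spec in H1, H2.
  assert (He2 : 0 < eps / 2) by lra.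
  destruct (H1 (mkposreal _ He2)) as [N1 HN1], (H2 (mkposreal _ He2)) as [N2 HN2].
  exists (max N1 N2). intros n Hn.
  specialize (HN1 n ltac:(lia)). specialize (HN2 n ltac:(lia)). simpl in HN1, HN2.
  eapply Rle_lt_trans; [apply Cmod_le_sum|]. simpl.
  unfold Rminus in *. lra.
Qed.

Lemma ccv_is_lim_seq (u : nat -> C) (l : C) :
  ccv u l -> is_lim_seq (fun n => fst (u n)) (fst l) /\ is_lim_seq (fun n => snd (u n)) (snd l).
Proof.
  intros H. split; apply is_lim_seq_spec; intros eps;
    destruct (H eps (cond_pos eps)) as [N HN]; exists N; intros n Hn;
    (eapply Rle_lt_trans; [|apply (HN n Hn)]).
  - apply (Rabs_fst_le_Cmod (u n - l)%C).
  - apply (Rabs_snd_le_Cmod (u n - l)%C).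
Qed.

Lemma clim_unique u l : ccv u l -> clim u = l.
Proof.
  intros H. destruct (ccv_is_lim_seq _ _ H) as [H1 H2]. unfold clim.
  rewrite (is_lim_seq_unique _ _ H1), (is_lim_seq_unique _ _ H2). destruct l; reflexivity.
Qed.

(** The exact partial geometric sum, with its factor [1 - q ^ k], is what makes the induction on [k]
    close. *)
Lemma geom_cauchy_diff (u : nat -> C) K q : 0 < q < 1 ->
  (forall n, Cmod (u (S n) - u n)%C <= K * q ^ n) ->
  forall n k, Cmod (u (n + k)%nat - u n)%C <= K / (1 - q) * q ^ n * (1 - q ^ k).
Proof.
  intros Hq H n. induction k as [|k IH].
  - rewrite Nat.add_0_r. replace (u n - u n)%C with (RtoC 0) by ring. rewrite Cmod_0.
    simpl. lra.
  - replace (u (n + S k)%nat - u n)%C with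
      ((u (S (n + k)) - u (n + k)%nat) + (u (n + k)%nat - u n))%C
      by (rewrite <- plus_n_Sm; ring).
    eapply Rle_trans; [apply Cmod_triangle|].
    specialize (H (n + k)%nat). rewrite pow_add in H.
    replace (K / (1 - q) * q ^ n * (1 - q ^ S k)) with
      (K * (q ^ n * q ^ k) + K / (1 - q) * q ^ n * (1 - q ^ k)) by (simpl; field; lra).
    lra.
Qed.

(** The rate depends on [K] and [q] alone. A common [K] for a family of sequences therefore gives
    uniform convergence, and this is how the infinite products and the series [phi] are treated. *)
Lemma geom_cauchy (u : nat -> C) K q : 0 < q < 1 ->
  (forall n, Cmod (u (S n) - u n)%C <= K * q ^ n) ->
  forall n, Cmod (u n - clim u)%C <= K / (1 - q) * q ^ n.
Proof.
  intros Hq H.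
  assert (K0 : 0 <= K) by (specialize (H 0%nat); simpl in H;
    pose proof (Cmod_ge_0 (u 1%nat - u 0%nat)); lra).
  assert (HB : forall n k, Cmod (u (n + k)%nat - u n)%C <= K / (1 - q) * q ^ n).
  { intros n k. eapply Rle_trans; [apply (geom_cauchy_diff u K q Hq H)|].
    assert (0 < q ^ k) by (apply pow_lt; lra).
    assert (0 <= K / (1 - q) * q ^ n).
    { apply Rmult_le_pos; [apply Rdiv_le_0_compat; lra | apply pow_le; lra]. }
    nra. }
  assert (Hcv : ccv u (clim u)).
  { assert (Hlim := is_lim_seq_geom_scal (K / (1 - q)) q ltac:(lra)).
    apply is_lim_seq_spec in Hlim.
    (* [p] stands for the real and the imaginary part, so that the Cauchy criterion is checked once
       for both. *)
    assert (Hc : forall p : C -> R, (forall z, Rabs (p z) <= Cmod z) ->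
        (forall z w, p (z - w)%C = p z - p w) -> ex_finite_lim_seq (fun n => p (u n))).
    { intros p Hp Hpm. apply ex_lim_seq_cauchy_corr. intros eps.
      assert (He : 0 < eps / 2) by (pose proof (cond_pos eps); lra).
      destruct (Hlim (mkposreal _ He)) as [N HN]. exists N. intros n m Hn Hm.
      specialize (HN N ltac:(lia)). simpl in HN. rewrite Rminus_0_r in HN.
      pose proof (Rle_abs (K / (1 - q) * q ^ N)).
      rewrite <- Hpm. eapply Rle_lt_trans; [apply Hp|].
      replace (u n - u m)%C with ((u n - u N) + - (u m - u N))%C by ring.
      eapply Rle_lt_trans; [apply Cmod_triangle|]. rewrite Cmod_opp.
      pose proof (HB N (n - N)%nat). pose proof (HB N (m - N)%nat).
      replace (N + (n - N))%nat with n in * by lia.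
      replace (N + (m - N))%nat with m in * by lia. lra. }
    apply is_lim_seq_ccv; apply Lim_seq_correct'; apply Hc;
      auto using Rabs_fst_le_Cmod, Rabs_snd_le_Cmod. }
  intros n. apply le_epsilon. intros eps He.
  destruct (Hcv eps He) as [N HN]. specialize (HN (n + N)%nat ltac:(lia)).
  replace (u n - clim u)%C with (- (u (n + N)%nat - u n) + (u (n + N)%nat - clim u))%C by ring.
  eapply Rle_trans; [apply Cmod_triangle|]. rewrite Cmod_opp.
  specialize (HB n N). lra.
Qed.

Lemma ccv_geom_cauchy (u : nat -> C) K q : 0 < q < 1 ->
  (forall n, Cmod (u (S n) - u n)%C <= K * q ^ n) -> ccv u (clim u).
Proof.
  intros Hq H. apply (ccv_squeeze _ _ (fun n => K / (1 - q) * q ^ n)).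
  - apply geom_cauchy; auto.
  - apply is_lim_seq_geom_scal; lra.
Qed.

(** * Finite and infinite q-shifted factorials *)

Fixpoint qp (q : R) (a : C) (n : nat) : C :=
  match n with
  | O => RtoC 1
  | S m => (qp q a m * (1 - RtoC (q ^ m) * a))%C
  end.
Definition qpinf (q : R) (a : C) : C := clim (qp q a).

Lemma pow_unit_interval q n : 0 < q < 1 -> 0 < q ^ n <= 1.
Proof.
  intros Hq. split; [apply pow_lt; lra|]. rewrite <- (pow1 n). apply pow_incr; lra.
Qed.

(** Each factor satisfies [|1 - q^k a| <= 1 + M q^k <= exp (M q^k)], and the exponents sum to
    [M (1 - q^n) / (1 - q)]. The bound is uniform in [n] and in [|a| <= M]. *)
Lemma qp_le q a n M : 0 < q < 1 -> Cmod a <= M -> Cmod (qp q a n) <= exp (M / (1 - q)).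
Proof.
  intros Hq Ha. pose proof (Cmod_ge_0 a).
  assert (H1 : Cmod (qp q a n) <= exp (M / (1 - q) * (1 - q ^ n))).
  { induction n as [|n IH].
    - simpl. rewrite Cmod_1. replace (M / (1 - q) * (1 - 1)) with 0 by ring. rewrite exp_0. lra.
    - simpl qp. rewrite Cmod_mult. destruct (pow_unit_interval q n Hq).
      replace (M / (1 - q) * (1 - q ^ S n)) with (M / (1 - q) * (1 - q ^ n) + M * q ^ n)
        by (simpl; field; lra).
      rewrite exp_plus. apply Rmult_le_compat; auto using Cmod_ge_0.
      eapply Rle_trans; [|apply exp_ineq1_le].
      eapply Rle_trans; [apply Cmod_triangle|]. rewrite Cmod_1, Cmod_opp, Cmod_mult, Cmod_R.
      rewrite Rabs_pos_eq by lra. nra. }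
  eapply Rle_trans; [exact H1|].
  assert (Hx : M / (1 - q) * (1 - q ^ n) <= M / (1 - q)).
  { destruct (pow_unit_interval q n Hq).
    assert (0 <= M / (1 - q)) by (apply Rdiv_le_0_compat; lra). nra. }
  destruct Hx as [Hx|Hx]; [left; apply exp_increasing; auto | rewrite Hx; lra].
Qed.

(** With [c = rho / (1 - rho)], each factor is at least [1 - rho x >= exp (- c x)] at [x = q^k],
    because [(1 - rho x) (1 + c x) = 1 + rho^2 x (1 - x) / (1 - rho) >= 1] on [[0, 1]]. Being
    uniform in [n], the bound passes to the infinite product and allows inverting it. *)
Lemma qp_ge q a n rho : 0 < q < 1 -> Cmod a <= rho -> rho < 1 ->
  exp (- (rho / (1 - rho) / (1 - q))) <= Cmod (qp q a n).
Proof.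
  intros Hq Ha Hr. pose proof (Cmod_ge_0 a).
  set (c := rho / (1 - rho)).
  assert (Hc : 0 <= c) by (apply Rdiv_le_0_compat; lra).
  assert (H1 : exp (- (c / (1 - q) * (1 - q ^ n))) <= Cmod (qp q a n)).
  { induction n as [|n IH].
    - simpl. rewrite Cmod_1. replace (- (c / (1 - q) * (1 - 1))) with 0 by ring. rewrite exp_0. lra.
    - simpl qp. rewrite Cmod_mult. destruct (pow_unit_interval q n Hq).
      replace (- (c / (1 - q) * (1 - q ^ S n))) with
        (- (c / (1 - q) * (1 - q ^ n)) + - (c * q ^ n)) by (simpl; field; lra).
      rewrite exp_plus. apply Rmult_le_compat; auto; try (left; apply exp_pos).
      apply Rle_trans with (1 - rho * q ^ n).
      + rewrite exp_Ropp. apply Rmult_le_reg_r with (exp (c * q ^ n)); [apply exp_pos|].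
        rewrite Rinv_l by (apply Rgt_not_eq, exp_pos).
        pose proof (exp_ineq1_le (c * q ^ n)) as He.
        apply Rle_trans with ((1 - rho * q ^ n) * (1 + c * q ^ n)).
        * unfold c. replace ((1 - rho * q ^ n) * (1 + rho / (1 - rho) * q ^ n)) with
            (1 + rho * rho * q ^ n * (1 - q ^ n) / (1 - rho)) by (field; lra).
          assert (0 <= rho * rho * q ^ n * (1 - q ^ n) / (1 - rho)); [|lra].
          apply Rdiv_le_0_compat; [|lra]. repeat apply Rmult_le_pos; lra.
        * apply Rmult_le_compat_l; auto. nra.
      + assert (1 <= Cmod (1 - RtoC (q ^ n) * a) + q ^ n * Cmod a).
        { assert (Ht := Cmod_triangle (1 - RtoC (q ^ n) * a) (RtoC (q ^ n) * a)).
          replace (1 - RtoC (q ^ n) * a + RtoC (q ^ n) * a)%C with (RtoC 1) in Ht by ring.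
          rewrite Cmod_1, (Cmod_mult (RtoC (q ^ n)) a), Cmod_R, (Rabs_pos_eq (q ^ n)) in Ht by lra.
          exact Ht. }
        nra. }
  eapply Rle_trans; [|exact H1].
  assert (Hx : - (c / (1 - q)) <= - (c / (1 - q) * (1 - q ^ n))).
  { destruct (pow_unit_interval q n Hq).
    assert (0 <= c / (1 - q)) by (apply Rdiv_le_0_compat; lra). nra. }
  destruct Hx as [Hx|Hx]; [left; apply exp_increasing; auto | rewrite Hx; lra].
Qed.

(** Consecutive products differ by [- (a; q)_n q^n a], so [qp_le] makes the increments geometric
    with a constant that depends on [a] only through [M]. *)
Lemma qp_tail q a M n : 0 < q < 1 -> Cmod a <= M ->
  Cmod (qp q a n - qpinf q a)%C <= exp (M / (1 - q)) * M / (1 - q) * q ^ n.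
Proof.
  intros Hq Ha. unfold qpinf. apply geom_cauchy; auto. clear n. intros n.
  simpl. replace (qp q a n * (1 - RtoC (q ^ n) * a) - qp q a n)%C with
    (- (qp q a n * (RtoC (q ^ n) * a)))%C by ring.
  rewrite Cmod_opp, !Cmod_mult, Cmod_R. destruct (pow_unit_interval q n Hq).
  rewrite Rabs_pos_eq by lra.
  replace (exp (M / (1 - q)) * M * q ^ n) with (exp (M / (1 - q)) * (q ^ n * M)) by ring.
  pose proof (Cmod_ge_0 a).
  apply Rmult_le_compat; auto using Cmod_ge_0, qp_le; nra.
Qed.

Lemma unif_cv_qp {T} (D : T -> Prop) q (g : T -> C) : 0 < q < 1 -> bounded_on D g ->
  unif_cv D (fun n x => qp q (g x) n) (fun x => qpinf q (g x)).
Proof.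
  intros Hq [M HM] eps He.
  assert (Hl := is_lim_seq_geom_scal (exp (M / (1 - q)) * M / (1 - q)) q ltac:(lra)).
  apply is_lim_seq_spec in Hl. destruct (Hl (mkposreal eps He)) as [N HN].
  exists N. intros n Hn x Hx. specialize (HN n Hn). simpl in HN. rewrite Rminus_0_r in HN.
  eapply Rle_lt_trans; [apply qp_tail; auto|]. eapply Rle_lt_trans; [apply Rle_abs|]. exact HN.
Qed.

Lemma ccv_qp q a : 0 < q < 1 -> ccv (qp q a) (qpinf q a).
Proof. intros Hq. apply ccv_unif_cv, (unif_cv_qp _ q (fun _ : unit => a)); auto using bounded_on_const. Qed.

Lemma ccv_Cmod_le u l M : ccv u l -> (forall n, Cmod (u n) <= M) -> Cmod l <= M.
Proof.
  intros H HM. apply le_epsilon. intros eps He. destruct (H eps He) as [N HN].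
  specialize (HN N ltac:(lia)). specialize (HM N).
  replace l with (u N + - (u N - l))%C by ring.
  eapply Rle_trans; [apply Cmod_triangle|]. rewrite Cmod_opp. lra.
Qed.

Lemma ccv_Cmod_ge u l m : ccv u l -> (forall n, m <= Cmod (u n)) -> m <= Cmod l.
Proof.
  intros H HM. apply le_epsilon. intros eps He. destruct (H eps He) as [N HN].
  specialize (HN N ltac:(lia)). specialize (HM N).
  apply Rle_trans with (Cmod (u N)); auto.
  replace (u N) with (l + (u N - l))%C by ring.
  eapply Rle_trans; [apply Cmod_triangle|].
  replace (l + (u N - l) - l)%C with (u N - l)%C by ring. lra.
Qed.

Lemma bounded_on_qpinf {T} (D : T -> Prop) q (g : T -> C) : 0 < q < 1 -> bounded_on D g ->
  bounded_on D (fun x => qpinf q (g x)).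
Proof.
  intros Hq [M HM]. exists (exp (M / (1 - q))). intros x Hx.
  eapply ccv_Cmod_le; [apply ccv_qp; auto|]. intros n. apply qp_le; auto.
Qed.

Lemma bounded_away_qpinf {T} (D : T -> Prop) q (g : T -> C) rho : 0 < q < 1 -> rho < 1 ->
  (forall x, D x -> Cmod (g x) <= rho) -> bounded_away D (fun x => qpinf q (g x)).
Proof.
  intros Hq Hr Hg. exists (exp (- (rho / (1 - rho) / (1 - q)))). split; [apply exp_pos|].
  intros x Hx. eapply ccv_Cmod_ge; [apply ccv_qp; auto|]. intros n. apply qp_ge; auto.
Qed.

Lemma qpinf_neq0 q a : 0 < q < 1 -> Cmod a < 1 -> qpinf q a <> RtoC 0.
Proof.
  intros Hq Ha. apply (bounded_away_neq (fun _ : unit => True) (fun _ => qpinf q a) tt); auto.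
  apply (bounded_away_qpinf _ q (fun _ => a) (Cmod a)); auto. intros; lra.
Qed.

Lemma qp_neq0 q a n : 0 < q < 1 -> Cmod a < 1 -> qp q a n <> RtoC 0.
Proof.
  intros Hq Ha. apply Cmod_gt_0. eapply Rlt_le_trans; [|apply (qp_ge q a n (Cmod a)); auto; lra].
  apply exp_pos.
Qed.

Lemma qp_add q a n k : qp q a (n + k) = (qp q a n * qp q (RtoC (q ^ n) * a) k)%C.
Proof.
  induction k as [|k IH].
  - rewrite Nat.add_0_r. simpl. ring.
  - rewrite <- plus_n_Sm. simpl. rewrite IH, pow_add, RtoC_mult. ring.
Qed.

Lemma qpinf_shift q a n : 0 < q < 1 ->
  qpinf q a = (qp q a n * qpinf q (RtoC (q ^ n) * a))%C.
Proof.
  intros Hq. apply (ccv_unique (fun k => qp q a (k + n)%nat)).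
  - apply ccv_incr, ccv_qp; auto.
  - apply (ccv_ext (fun k => qp q a n * qp q (RtoC (q ^ n) * a) k)%C).
    + intros k. rewrite <- qp_add. f_equal. lia.
    + apply ccv_mult; [apply ccv_const | apply ccv_qp; auto].
Qed.

Lemma qpinf_step q a : 0 < q < 1 -> qpinf q a = ((1 - a) * qpinf q (RtoC q * a))%C.
Proof.
  intros Hq. rewrite (qpinf_shift q a 1 Hq). simpl. rewrite Rmult_1_r. ring.
Qed.

Lemma qpinf_0 q : 0 < q < 1 -> qpinf q (RtoC 0) = RtoC 1.
Proof.
  intros Hq. apply (ccv_unique (qp q (RtoC 0))); [apply ccv_qp; auto|].
  apply (ccv_ext (fun _ => RtoC 1)); [|apply ccv_const].
  induction n as [|n IH]; simpl; auto. rewrite <- IH. ring.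
Qed.

(* Each [1 - x^2 q^k] splits into [(1 - x s^k) (1 + x s^k)]; the four products collect
   the even and the odd [k]. *)
Lemma qpinf_square s x : 0 < s < 1 ->
  let P := qpinf (s * s) in
  P (x * x)%C = (P x * P (- x) * P (RtoC s * x) * P (- (RtoC s * x)))%C.
Proof.
  intros Hs P. assert (Hq : 0 < s * s < 1) by nra.
  apply (ccv_unique (fun n => qp (s * s) (x * x) (n + n))).
  - intros eps He. destruct (ccv_qp (s * s) (x * x)%C Hq eps He) as [N HN].
    exists N. intros n Hn. apply HN. lia.
  - apply (ccv_ext (fun n => qp (s * s) x n * qp (s * s) (- x) n * qp (s * s) (RtoC s * x) n
                             * qp (s * s) (- (RtoC s * x)) n)%C).
    + induction n as [|n IH]; [simpl; ring|].
      replace (S n + S n)%nat with (S (S (n + n))) by lia.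
      cbn [qp]. rewrite <- IH. cbn [pow]. rewrite pow_add, !RtoC_mult. ring.
    + repeat apply ccv_mult; apply ccv_qp; auto.
Qed.

(** * Continuity and integrals of complex functions of a real variable *)

Definition ccont (f : R -> C) : Prop :=
  forall t, continuous (fun x => fst (f x)) t /\ continuous (fun x => snd (f x)) t.
(** Taken coordinatewise, like [CInt], so that the final transfer reduces to real Riemann
    integrals. *)
Definition CI (f : R -> C) (lo hi : R) : C :=
  (RInt (fun t => fst (f t)) lo hi, RInt (fun t => snd (f t)) lo hi).

Lemma ccont_ext f g : (forall t, f t = g t) -> ccont f -> ccont g.
Proof.
  intros E H t. destruct (H t) as [H1 H2]. split.
  - apply (continuous_ext (fun x => fst (f x))); auto. intros x; rewrite E; reflexivity.
  - apply (continuous_ext (fun x => snd (f x))); auto. intros x; rewrite E; reflexivity.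
Qed.

Lemma ccont_const c : ccont (fun _ => c).
Proof. intros t; split; apply continuous_const. Qed.

Lemma ccont_plus f g : ccont f -> ccont g -> ccont (fun t => f t + g t)%C.
Proof.
  intros Hf Hg t. destruct (Hf t), (Hg t).
  split; simpl; apply (continuous_plus (V := R_NormedModule)); auto.
Qed.

Lemma ccont_mult f g : ccont f -> ccont g -> ccont (fun t => f t * g t)%C.
Proof.
  intros Hf Hg t. destruct (Hf t), (Hg t). split; simpl.
  - apply (continuous_minus (V := R_NormedModule));
      apply (continuous_mult (K := R_AbsRing)); auto.
  - apply (continuous_plus (V := R_NormedModule));
      apply (continuous_mult (K := R_AbsRing)); auto.
Qed.

Lemma ccont_inv f : ccont f -> (forall t, f t <> RtoC 0) -> ccont (fun t => / f t)%C.
Proof.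
  intros Hf Hn t. destruct (Hf t).
  assert (Hd : continuous (fun x => / (fst (f x) ^ 2 + snd (f x) ^ 2)) t).
  { apply continuous_Rinv_comp.
    - apply (continuous_ext (fun x => fst (f x) * fst (f x) + snd (f x) * snd (f x))).
      + intros x; simpl; ring.
      + apply (continuous_plus (V := R_NormedModule));
          apply (continuous_mult (K := R_AbsRing)); auto.
    - intros E. apply (Hn t), injective_projections; simpl; nra. }
  split; simpl; unfold Rdiv; apply (continuous_mult (K := R_AbsRing)); auto.
  apply (continuous_opp (V := R_NormedModule)); auto.
Qed.

(** An [eps / 3] argument. One approximant for each [eps] is enough, so the lemma serves uniform
    limits of sequences and approximation by Laurent polynomials alike. *)
Lemma ccont_approx g :
  (forall eps, 0 < eps -> exists f, ccont f /\ forall t, Cmod (f t - g t)%C < eps) -> ccont g.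
Proof.
  intros H.
  assert (Hc : forall p : C -> R, (forall z, Rabs (p z) <= Cmod z) ->
      (forall z w, p (z - w)%C = p z - p w) ->
      (forall f, ccont f -> forall t, continuous (fun x => p (f x)) t) ->
      forall t, continuous (fun x => p (g x)) t).
  { intros p Hp Hm Hcont t. apply filterlim_locally. intros eps.
    assert (He : 0 < eps / 3) by (pose proof (cond_pos eps); lra).
    destruct (H _ He) as [f [Hf Hfg]].
    specialize (Hcont f Hf t). apply filterlim_locally with (eps := mkposreal _ He) in Hcont.
    revert Hcont. apply filter_imp. intros x Hx.
    change (Rabs (p (f x) - p (f t)) < eps / 3) in Hx.
    change (Rabs (p (g x) - p (g t)) < eps).
    assert (H1 : Rabs (p (f x) - p (g x)) < eps / 3)
      by (rewrite <- Hm; eapply Rle_lt_trans; [apply Hp | apply Hfg]).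
    assert (H2 : Rabs (p (f t) - p (g t)) < eps / 3)
      by (rewrite <- Hm; eapply Rle_lt_trans; [apply Hp | apply Hfg]).
    apply Rabs_def2 in Hx, H1, H2. apply Rabs_def1; lra. }
  intros t. split; revert t; apply Hc; auto using Rabs_fst_le_Cmod, Rabs_snd_le_Cmod;
    intros f Hf t; apply (Hf t).
Qed.

Lemma ccont_unif_cv f g : (forall n, ccont (f n)) -> unif_cv (fun _ => True) f g -> ccont g.
Proof.
  intros Hf H. apply ccont_approx. intros eps He. destruct (H eps He) as [N HN].
  exists (f N). split; auto.
Qed.

Lemma ccont_ex_RInt f a b : ccont f ->
  ex_RInt (fun t => fst (f t)) a b /\ ex_RInt (fun t => snd (f t)) a b.
Proof.
  intros H; split; apply (ex_RInt_continuous (V := R_CompleteNormedModule));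
    intros t _; apply (H t).
Qed.

Lemma CI_ext f g a b : (forall t, f t = g t) -> CI f a b = CI g a b.
Proof. intros E. unfold CI. f_equal; apply RInt_ext; intros; rewrite E; reflexivity. Qed.

Lemma CI_plus f g a b : ccont f -> ccont g ->
  CI (fun t => f t + g t)%C a b = (CI f a b + CI g a b)%C.
Proof.
  intros Hf Hg. destruct (ccont_ex_RInt f a b Hf), (ccont_ex_RInt g a b Hg).
  apply injective_projections; simpl; apply (RInt_plus (V := R_CompleteNormedModule)); auto.
Qed.

Lemma CI_scal c f a b : ccont f -> CI (fun t => c * f t)%C a b = (c * CI f a b)%C.
Proof.
  intros Hf. destruct (ccont_ex_RInt f a b Hf) as [H1 H2].
  assert (Hs : forall k (h : R -> R), ex_RInt h a b -> ex_RInt (fun t => k * h t) a b)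
    by (intros k h Hh; apply (ex_RInt_scal (V := R_NormedModule) h); auto).
  assert (Es : forall k (h : R -> R), ex_RInt h a b -> RInt (fun t => k * h t) a b = k * RInt h a b)
    by (intros k h Hh; apply (RInt_scal (V := R_CompleteNormedModule) h); auto).
  apply injective_projections; simpl; rewrite <- !Es by auto.
  - apply (RInt_minus (V := R_CompleteNormedModule)); auto.
  - apply (RInt_plus (V := R_CompleteNormedModule)); auto.
Qed.

(** The factor 2 comes from estimating the real and the imaginary part separately; only smallness
    matters in its applications. *)
Lemma CI_bound f a b M : a <= b -> ccont f -> (forall t, Cmod (f t) <= M) ->
  Cmod (CI f a b) <= 2 * ((b - a) * M).
Proof.
  intros Hab Hf HM. destruct (ccont_ex_RInt f a b Hf) as [H1 H2].
  eapply Rle_trans; [apply Cmod_le_sum|]. simpl.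
  assert (Rabs (RInt (fun t => fst (f t)) a b) <= (b - a) * M).
  { apply abs_RInt_le_const; auto. intros t _. eapply Rle_trans; [apply Rabs_fst_le_Cmod | auto]. }
  assert (Rabs (RInt (fun t => snd (f t)) a b) <= (b - a) * M).
  { apply abs_RInt_le_const; auto. intros t _. eapply Rle_trans; [apply Rabs_snd_le_Cmod | auto]. }
  lra.
Qed.

Lemma CI_dist f g a b M : a <= b -> ccont f -> ccont g ->
  (forall t, Cmod (f t - g t)%C <= M) -> Cmod (CI f a b - CI g a b)%C <= 2 * ((b - a) * M).
Proof.
  intros Hab Hf Hg HM.
  assert (Hg' : ccont (fun t => - (1) * g t)%C) by (apply ccont_mult; auto using ccont_const).
  replace (CI f a b - CI g a b)%C with (CI (fun t => f t + - (1) * g t)%C a b).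
  - apply CI_bound; auto using ccont_plus. intros t.
    replace (f t + - (1) * g t)%C with (f t - g t)%C by ring. auto.
  - rewrite CI_plus, CI_scal by auto. ring.
Qed.

Lemma ccv_CI f g a b : a <= b -> (forall n, ccont (f n)) -> unif_cv (fun _ => True) f g ->
  ccv (fun n => CI (f n) a b) (CI g a b).
Proof.
  intros Hab Hf H eps He. assert (Hg := ccont_unif_cv _ _ Hf H).
  (* The [+ 1] keeps the denominator positive when [a = b] and makes the final inequality strict. *)
  assert (He' : 0 < eps / (2 * (b - a) + 1)) by (apply Rdiv_lt_0_compat; lra).
  destruct (H _ He') as [N HN]. exists N. intros n Hn.
  eapply Rle_lt_trans; [apply (CI_dist _ _ _ _ (eps / (2 * (b - a) + 1))); auto|].
  - intros t. left. auto.
  - replace eps with (eps / (2 * (b - a) + 1) * (2 * (b - a) + 1)) at 2 by (field; lra).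
    nra.
Qed.

Lemma RInt_even (f : R -> R) a : (forall t, continuous f t) -> (forall t, f (- t) = f t) ->
  RInt f (- a) a = 2 * RInt f 0 a.
Proof.
  intros Hf He.
  assert (Hex : forall u v, ex_RInt f u v)
    by (intros; apply (ex_RInt_continuous (V := R_CompleteNormedModule)); auto).
  assert (H := RInt_Chasles (V := R_CompleteNormedModule) f (- a) 0 a (Hex _ _) (Hex _ _)).
  rewrite <- H. change (RInt f (- a) 0 + RInt f 0 a = 2 * RInt f 0 a).
  assert (E : RInt f (- a) 0 = RInt f 0 a); [|rewrite E; ring].
  assert (H1 := RInt_comp_lin (V := R_CompleteNormedModule) f (-1) 0 a 0 (Hex _ _)).
  replace (-1 * a + 0) with (- a) in H1 by ring. replace (-1 * 0 + 0) with 0 in H1 by ring.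
  rewrite <- H1, <- (opp_RInt_swap (V := R_CompleteNormedModule) f) by auto.
  rewrite <- (RInt_opp (V := R_CompleteNormedModule) f) by auto.
  apply RInt_ext. intros t _. change (-1 * f (-1 * t + 0) = - f t).
  replace (-1 * t + 0) with (- t) by ring. rewrite He. ring.
Qed.

Lemma CI_even f a : ccont f -> (forall t, f (- t) = f t) -> CI f (- a) a = (2 * CI f 0 a)%C.
Proof.
  intros Hf He. unfold CI.
  rewrite !RInt_even; try (intros; apply Hf); try (intros; rewrite He; reflexivity).
  apply injective_projections; simpl; ring.
Qed.

(** * The exponentials [e^(ikt)] *)

Definition ei (t : R) : C := (cos t, sin t).

Lemma ei_plus s t : ei (s + t) = (ei s * ei t)%C.
Proof. apply injective_projections; simpl; [apply cos_plus | rewrite sin_plus; ring]. Qed.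

Lemma ei_0 : ei 0 = RtoC 1.
Proof. apply injective_projections; simpl; [apply cos_0 | apply sin_0]. Qed.

Lemma Cmod_ei t : Cmod (ei t) = 1.
Proof.
  unfold Cmod, ei; simpl. rewrite !Rmult_1_r, <- sqrt_1. f_equal.
  pose proof (sin2_cos2 t). unfold Rsqr in *. lra.
Qed.

Lemma ei_neq0 t : ei t <> RtoC 0.
Proof. apply Cmod_gt_0. rewrite Cmod_ei. lra. Qed.

Lemma ei_opp t : ei (- t) = (/ ei t)%C.
Proof.
  assert (H := ei_plus t (- t)). rewrite Rplus_opp_r, ei_0 in H.
  replace (ei (- t)) with (/ ei t * (ei t * ei (- t)))%C by (field; apply ei_neq0).
  rewrite <- H. ring.
Qed.

Lemma ei_pow t n : (ei t ^ n)%C = ei (INR n * t).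
Proof.
  induction n as [|n IH].
  - simpl. rewrite Rmult_0_l, ei_0. reflexivity.
  - rewrite Cpow_S, IH, <- ei_plus, S_INR. f_equal. ring.
Qed.

Lemma ccont_ei k : ccont (fun t => ei (k * t)).
Proof.
  intros t. split; simpl.
  - apply (continuous_comp (fun x => k * x) cos); [|apply continuous_cos].
    apply (continuous_mult (K := R_AbsRing)); [apply continuous_const | apply continuous_id].
  - apply (continuous_comp (fun x => k * x) sin); [|apply continuous_sin].
    apply (continuous_mult (K := R_AbsRing)); [apply continuous_const | apply continuous_id].
Qed.

(** The frequency [k] is a real number, and [sin (k * PI) = 0] encodes that it is an integer of
    either sign. *)
Lemma CI_ei k : k <> 0 -> sin (k * PI) = 0 -> CI (fun t => ei (k * t)) (- PI) PI = RtoC 0.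
Proof.
  intros Hk Hs. unfold CI, ei; simpl. apply injective_projections; simpl.
  - replace 0 with (sin (k * PI) / k - sin (k * - PI) / k).
    + apply is_RInt_unique.
      apply (is_RInt_derive (fun t => sin (k * t) / k) (fun t => cos (k * t))).
      * intros t _. auto_derive; auto. field; auto.
      * intros t _. apply (ccont_ei k t).
    + replace (k * - PI) with (- (k * PI)) by ring. rewrite sin_neg, Hs. field; auto.
  - replace 0 with (- cos (k * PI) / k - - cos (k * - PI) / k).
    + apply is_RInt_unique.
      apply (is_RInt_derive (fun t => - cos (k * t) / k) (fun t => sin (k * t))).
      * intros t _. auto_derive; auto. field; auto.
      * intros t _. apply (ccont_ei k t).
    + replace (k * - PI) with (- (k * PI)) by ring. rewrite cos_neg. field; auto.
Qed.

(** * Shifting the contour from [|z| = 1] to [|z| = q] *)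

(** The two natural exponents encode the integer power [z^(m - n)]. Equality is asked off the origin
    only, where [/ z] is a true inverse. *)
Inductive laurent : (C -> C) -> Prop :=
| laurent_mono m n : laurent (fun z => z ^ m * (/ z) ^ n)%C
| laurent_plus f g : laurent f -> laurent g -> laurent (fun z => f z + g z)%C
| laurent_scal c f : laurent f -> laurent (fun z => c * f z)%C
| laurent_ext f g : (forall z, z <> RtoC 0 -> f z = g z) -> laurent f -> laurent g.

Lemma laurent_mult f g : laurent f -> laurent g -> laurent (fun z => f z * g z)%C.
Proof.
  intros Hf Hg. induction Hf as [m n|f1 f2 _ IH1 _ IH2|c f _ IH|f1 f2 E _ IH].
  - induction Hg as [m' n'|f1 f2 _ IH1 _ IH2|c f _ IH|f1 f2 E _ IH].
    + eapply laurent_ext; [|apply (laurent_mono (m + m') (n + n'))].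
      intros z Hz. simpl. rewrite !Cpow_add_r. ring.
    + eapply laurent_ext; [|apply (laurent_plus _ _ IH1 IH2)]. intros z Hz; simpl; ring.
    + eapply laurent_ext; [|apply (laurent_scal c _ IH)]. intros z Hz; simpl; ring.
    + eapply laurent_ext; [|apply IH]. intros z Hz; simpl; rewrite E; auto.
  - eapply laurent_ext; [|apply (laurent_plus _ _ IH1 IH2)]. intros z Hz; simpl; ring.
  - eapply laurent_ext; [|apply (laurent_scal c _ IH)]. intros z Hz; simpl; ring.
  - eapply laurent_ext; [|apply IH]. intros z Hz; simpl; rewrite E; auto.
Qed.

Lemma RtoC_neq0 r : r <> 0 -> RtoC r <> RtoC 0.
Proof. intros H E. apply H, RtoC_inj, E. Qed.

Lemma mono_polar r t m n : 0 < r ->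
  ((RtoC r * ei t) ^ m * (/ (RtoC r * ei t)) ^ n)%C =
  (RtoC (r ^ m / r ^ n) * ei ((INR m - INR n) * t))%C.
Proof.
  intros Hr. assert (RtoC r <> RtoC 0) by (apply RtoC_neq0; lra).
  assert (Hrn : RtoC (r ^ n) <> RtoC 0) by (apply RtoC_neq0, pow_nonzero; lra).
  replace ((INR m - INR n) * t) with (INR m * t + - (INR n * t)) by ring.
  rewrite ei_plus, ei_opp, Cpow_inv, !Cpow_mult_l, !ei_pow
    by (apply Cmult_neq_0; auto using ei_neq0).
  rewrite RtoC_div, !RtoC_pow in * by (apply pow_nonzero; lra).
  field. auto using ei_neq0.
Qed.

Lemma ccont_laurent f r : 0 < r -> laurent f -> ccont (fun t => f (RtoC r * ei t)%C).
Proof.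
  intros Hr Hf. induction Hf as [m n|f1 f2 _ IH1 _ IH2|c f _ IH|f1 f2 E _ IH].
  - eapply ccont_ext; [intros t; symmetry; apply mono_polar; auto|].
    apply ccont_mult; auto using ccont_const, ccont_ei.
  - apply ccont_plus; auto.
  - apply ccont_mult; auto using ccont_const.
  - eapply ccont_ext; [|apply IH]. intros t. apply E.
    apply Cmult_neq_0; auto using ei_neq0. apply RtoC_neq0; lra.
Qed.

Lemma sin_INR_PI n : sin (INR n * PI) = 0.
Proof. rewrite <- (Rplus_0_l (INR n * PI)), INR_IZR_INZ. apply sin_eq_0_1. eexists. rewrite Rplus_0_l. reflexivity. Qed.

(** On [|z| = r] a monomial is [r^(m-n) e^(i(m-n)t)]: it integrates to 0 unless [m = n], and then
    the radius drops out. *)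
Lemma CI_laurent f r : 0 < r -> laurent f ->
  CI (fun t => f (RtoC r * ei t)%C) (- PI) PI = CI (fun t => f (ei t)) (- PI) PI.
Proof.
  intros Hr Hf.
  assert (Hone : forall g, laurent g -> ccont (fun t => g (ei t))).
  { intros g Hg. eapply ccont_ext; [|apply (ccont_laurent g 1); auto; lra].
    intros t; simpl. f_equal. ring. }
  induction Hf as [m n|f1 f2 H1 IH1 H2 IH2|c f H IH|f1 f2 E H IH].
  - rewrite (CI_ext _ _ _ _ (fun t => mono_polar r t m n Hr)).
    rewrite (CI_ext (fun t => ei t ^ m * (/ ei t) ^ n)%C
               (fun t => 1 * ei ((INR m - INR n) * t))%C).
    + rewrite !CI_scal by apply ccont_ei.
      destruct (Nat.eq_dec m n) as [->|Hmn].
      * replace (r ^ n / r ^ n) with 1 by (field; apply pow_nonzero; lra). reflexivity.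
      * assert (Hk : INR m - INR n <> 0) by (intros E; apply Hmn, INR_eq; lra).
        rewrite CI_ei; [ring|auto|].
        replace ((INR m - INR n) * PI) with (INR m * PI - INR n * PI) by ring.
        rewrite sin_minus, !sin_INR_PI. ring.
    + intros t. assert (Ht := mono_polar 1 t m n ltac:(lra)).
      rewrite !pow1, !Cmult_1_l in Ht. rewrite Ht. f_equal. f_equal. field.
  - rewrite !CI_plus; auto using ccont_laurent. congruence.
  - rewrite !CI_scal; auto using ccont_laurent. congruence.
  - transitivity (CI (fun t => f1 (RtoC r * ei t)%C) (- PI) PI).
    + apply CI_ext. intros t. symmetry. apply E.
      apply Cmult_neq_0; auto using ei_neq0. apply RtoC_neq0; lra.
    + rewrite IH. apply CI_ext. intros t. apply E, ei_neq0.
Qed.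

(** Only the boundary of the annulus enters: what lies between is accounted for by the exact
    equality for Laurent polynomials. *)
Definition two_circles (q : R) (z : C) : Prop := Cmod z = 1 \/ Cmod z = q.
Definition approx (q : R) (g : C -> C) : Prop :=
  forall eps, 0 < eps -> exists f, laurent f /\
  forall z, two_circles q z -> Cmod (f z - g z)%C < eps.

Lemma two_circles_neq0 q z : 0 < q -> two_circles q z -> z <> RtoC 0.
Proof. intros Hq [H|H]; apply Cmod_gt_0; lra. Qed.

(** The substitute for Cauchy's theorem applied to [g z / z]: both integrals are close to the common
    integral of one Laurent polynomial. *)
Lemma CI_approx q g : 0 < q < 1 -> approx q g ->
  ccont (fun t => g (ei t)) /\ ccont (fun t => g (RtoC q * ei t)%C) /\
  CI (fun t => g (RtoC q * ei t)%C) (- PI) PI = CI (fun t => g (ei t)) (- PI) PI.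
Proof.
  intros Hq Hg.
  assert (S1 : forall t, two_circles q (ei t)) by (intros t; left; apply Cmod_ei).
  assert (Sq : forall t, two_circles q (RtoC q * ei t)%C).
  { intros t; right. rewrite Cmod_mult, Cmod_ei, Cmod_R, Rabs_pos_eq; lra. }
  assert (C1' : forall f, laurent f -> ccont (fun t => f (ei t))).
  { intros f Hf. eapply ccont_ext; [|apply (ccont_laurent f 1); auto; lra].
    intros t; simpl. f_equal. ring. }
  assert (Cq' : forall f, laurent f -> ccont (fun t => f (RtoC q * ei t)%C))
    by (intros; apply ccont_laurent; auto; lra).
  assert (C1 : ccont (fun t => g (ei t))).
  { apply ccont_approx. intros eps He. destruct (Hg eps He) as [f [Hf Hfg]].
    exists (fun t => f (ei t)). split; auto. }
  assert (Cq : ccont (fun t => g (RtoC q * ei t)%C)).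
  { apply ccont_approx. intros eps He. destruct (Hg eps He) as [f [Hf Hfg]].
    exists (fun t => f (RtoC q * ei t)%C). split; auto. }
  split; [|split]; auto. pose proof PI_RGT_0.
  (* The equality is read off as uniqueness of the limit of a constant sequence: the distance is
     below every [eps]. *)
  apply (ccv_unique (fun _ : nat => CI (fun t => g (RtoC q * ei t)%C) (- PI) PI));
    [apply ccv_const|].
  intros eps He. exists 0%nat. intros _ _.
  (* On an interval of length [2 PI], [CI_dist] costs [4 PI] times the uniform error, and it is
     applied once per circle. *)
  destruct (Hg (eps / (8 * PI + 1)) ltac:(apply Rdiv_lt_0_compat; lra)) as [f [Hf Hfg]].
  assert (E1 := CI_dist (fun t => f (ei t)) (fun t => g (ei t)) (- PI) PI (eps / (8 * PI + 1))
                 ltac:(lra) (C1' f Hf) C1 (fun t => Rlt_le _ _ (Hfg _ (S1 t)))).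
  assert (Eq := CI_dist (fun t => f (RtoC q * ei t)%C) (fun t => g (RtoC q * ei t)%C) (- PI) PI
                 (eps / (8 * PI + 1))
                 ltac:(lra) (Cq' f Hf) Cq (fun t => Rlt_le _ _ (Hfg _ (Sq t)))).
  rewrite (CI_laurent f q ltac:(lra) Hf) in Eq.
  set (x := CI (fun t => f (ei t)) (- PI) PI) in *.
  set (y := CI (fun t => g (ei t)) (- PI) PI) in *.
  set (w := CI (fun t => g (RtoC q * ei t)%C) (- PI) PI) in *.
  replace (w - y)%C with (- (x - w) + (x - y))%C by ring.
  eapply Rle_lt_trans; [apply Cmod_triangle|]. rewrite Cmod_opp.
  assert (Hx : eps / (8 * PI + 1) * (8 * PI + 1) = eps) by (field; lra).
  assert (0 < eps / (8 * PI + 1)) by (apply Rdiv_lt_0_compat; lra).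
  lra.
Qed.

Lemma approx_laurent q f : laurent f -> approx q f.
Proof.
  intros Hf eps He. exists f. split; auto. intros z _.
  replace (f z - f z)%C with (RtoC 0) by ring. rewrite Cmod_0; auto.
Qed.

Lemma approx_ext q f g : (forall z, two_circles q z -> f z = g z) -> approx q f -> approx q g.
Proof.
  intros E H eps He. destruct (H eps He) as [p [Hp Hpf]]. exists p. split; auto.
  intros z Hz. rewrite <- E; auto.
Qed.

Lemma approx_const q c : approx q (fun _ => c).
Proof.
  apply approx_laurent. apply (laurent_ext (fun z => c * (z ^ 0 * (/ z) ^ 0))%C).
  - intros; simpl; ring.
  - apply laurent_scal, laurent_mono.
Qed.

Lemma approx_pow q m : approx q (fun z => z ^ m)%C.
Proof.
  apply approx_laurent. apply (laurent_ext (fun z => z ^ m * (/ z) ^ 0)%C).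
  - intros; simpl; ring.
  - apply laurent_mono.
Qed.

Lemma approx_inv_pow q m : approx q (fun z => (/ z) ^ m)%C.
Proof.
  apply approx_laurent. apply (laurent_ext (fun z => z ^ 0 * (/ z) ^ m)%C).
  - intros; simpl; ring.
  - apply laurent_mono.
Qed.

Lemma bounded_on_laurent q f : 0 < q < 1 -> laurent f -> bounded_on (two_circles q) f.
Proof.
  intros Hq Hf. induction Hf as [m n|f1 f2 _ [M1 H1] _ [M2 H2]|c f _ IH|f1 f2 E _ [M IH]].
  - exists (1 * / q ^ n). intros z Hz. assert (Hz0 := two_circles_neq0 q z ltac:(lra) Hz).
    assert (Hz1 : q <= Cmod z <= 1) by (destruct Hz as [H|H]; rewrite H; lra).
    rewrite Cmod_mult, !Cmod_pow, Cmod_inv, pow_inv by auto.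
    assert (0 < q ^ n) by (apply pow_lt; lra).
    assert (q ^ n <= Cmod z ^ n) by (apply pow_incr; lra).
    apply Rmult_le_compat.
    + apply pow_le; lra.
    + left; apply Rinv_0_lt_compat; lra.
    + rewrite <- (pow1 m). apply pow_incr; lra.
    + apply Rinv_le_contravar; auto.
  - exists (M1 + M2). intros z Hz. eapply Rle_trans; [apply Cmod_triangle|].
    specialize (H1 z Hz); specialize (H2 z Hz); lra.
  - apply bounded_on_mult; auto using bounded_on_const.
  - exists M. intros z Hz. rewrite <- E by (apply (two_circles_neq0 q); auto; lra). auto.
Qed.

Lemma bounded_on_approx q g : 0 < q < 1 -> approx q g -> bounded_on (two_circles q) g.
Proof.
  intros Hq Hg. destruct (Hg 1 ltac:(lra)) as [f [Hf Hfg]].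
  destruct (bounded_on_laurent q f Hq Hf) as [M HM]. exists (M + 1). intros z Hz.
  specialize (HM z Hz). specialize (Hfg z Hz).
  replace (g z) with (f z + - (f z - g z))%C by ring.
  eapply Rle_trans; [apply Cmod_triangle|]. rewrite Cmod_opp. lra.
Qed.

Lemma approx_unif_cv q f g : (forall n, approx q (f n)) -> unif_cv (two_circles q) f g -> approx q g.
Proof.
  intros Hf H eps He. destruct (H (eps / 2) ltac:(lra)) as [N HN].
  destruct (Hf N (eps / 2) ltac:(lra)) as [p [Hp Hpf]]. exists p. split; auto. intros z Hz.
  specialize (HN N ltac:(lia) z Hz). specialize (Hpf z Hz).
  replace (p z - g z)%C with ((p z - f N z) + (f N z - g z))%C by ring.
  eapply Rle_lt_trans; [apply Cmod_triangle|]. lra.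
Qed.

(** Choosing an approximant for each error [1 / (n + 1)] turns the [eps] form into a sequence, so
    that [unif_cv_mult] yields products. *)
Lemma approx_seq q g : approx q g ->
  exists f, (forall n, laurent (f n)) /\ unif_cv (two_circles q) f g.
Proof.
  intros H.
  assert (Hn : forall n : nat, 0 < / (INR n + 1))
    by (intros n; apply Rinv_0_lt_compat; pose proof (pos_INR n); lra).
  assert (Hs : forall n : nat, { f | laurent f /\
      forall z, two_circles q z -> Cmod (f z - g z)%C < / (INR n + 1) }).
  { intros n. apply ClassicalEpsilon.constructive_indefinite_description, H, Hn. }
  exists (fun n => proj1_sig (Hs n)). split.
  - intros n. apply (proj2_sig (Hs n)).
  - intros eps He. destruct (INR_unbounded (/ eps)) as [N HN]. exists N. intros n Hn' z Hz.
    eapply Rlt_trans; [apply (proj2_sig (Hs n)); auto|].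
    apply le_INR in Hn'. rewrite <- (Rinv_inv eps).
    assert (0 < / eps) by (apply Rinv_0_lt_compat; auto).
    apply Rinv_lt_contravar; [apply Rmult_lt_0_compat|]; lra.
Qed.

Lemma approx_mult q f g : 0 < q < 1 -> approx q f -> approx q g -> approx q (fun z => f z * g z)%C.
Proof.
  intros Hq Hf Hg.
  destruct (approx_seq q f Hf) as [fn [Lf Uf]], (approx_seq q g Hg) as [gn [Lg Ug]].
  apply (approx_unif_cv q (fun n z => fn n z * gn n z)%C).
  - intros n. apply approx_laurent, laurent_mult; auto.
  - apply unif_cv_mult; auto using bounded_on_approx.
Qed.

Lemma approx_plus q f g : approx q f -> approx q g -> approx q (fun z => f z + g z)%C.
Proof.
  intros Hf Hg eps He.
  destruct (Hf (eps / 2) ltac:(lra)) as [p [Hp Hpf]], (Hg (eps / 2) ltac:(lra)) as [r [Hr Hrg]].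
  exists (fun z => p z + r z)%C. split; [apply laurent_plus; auto|]. intros z Hz.
  specialize (Hpf z Hz). specialize (Hrg z Hz).
  replace (p z + r z - (f z + g z))%C with ((p z - f z) + (r z - g z))%C by ring.
  eapply Rle_lt_trans; [apply Cmod_triangle|]. lra.
Qed.

(** The partial sums of the geometric series in [g z] leave the remainder [- g^n / (1 - g)], of
    modulus at most [rho^n / (1 - rho)] on both circles. *)
Lemma approx_geom q g rho : 0 < q < 1 -> approx q g -> 0 < rho < 1 ->
  (forall z, two_circles q z -> Cmod (g z) <= rho) -> approx q (fun z => / (1 - g z))%C.
Proof.
  intros Hq Hg Hr HB.
  assert (Hp : forall n, approx q (fun z => g z ^ n)%C).
  { induction n as [|n IH]; simpl; [apply approx_const | apply approx_mult; auto]. }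
  apply (approx_unif_cv q (fun n z => csum (fun k => g z ^ k)%C n)).
  - induction n as [|n IH]; simpl; [apply approx_const | apply approx_plus; auto].
  - intros eps He.
    assert (Hl := is_lim_seq_geom_scal (/ (1 - rho)) rho ltac:(lra)).
    apply is_lim_seq_spec in Hl. destruct (Hl (mkposreal eps He)) as [N HN].
    exists N. intros n Hn z Hz. specialize (HN n Hn). simpl in HN. rewrite Rminus_0_r in HN.
    eapply Rle_lt_trans; [|eapply Rle_lt_trans; [apply Rle_abs|exact HN]].
    specialize (HB z Hz). set (x := g z) in *.
    assert (H1 : 1 - rho <= Cmod (1 - x)).
    { assert (Ht := Cmod_triangle (1 - x) x). replace (1 - x + x)%C with (RtoC 1) in Ht by ring.
      rewrite Cmod_1 in Ht. lra. }
    assert (H0 : (1 - x)%C <> RtoC 0) by (apply Cmod_gt_0; lra).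
    assert (E : csum (fun k => x ^ k)%C n = ((1 - x ^ n) / (1 - x))%C).
    { induction n as [|n IH]; simpl.
      - field; auto.
      (* [IH] carries the bounds on [n] as premises; the closed form holds for every [n] and is
         proved afresh without them. *)
      - clear - H0. induction n as [|n IH]; simpl; [field; auto|]. rewrite IH. field; auto. }
    rewrite E. replace ((1 - x ^ n) / (1 - x) - / (1 - x))%C with (/ (1 - x) * - x ^ n)%C
      by (field; auto).
    rewrite Cmod_mult, Cmod_opp, Cmod_pow, Cmod_inv by auto.
    apply Rmult_le_compat.
    + left; apply Rinv_0_lt_compat; lra.
    + apply pow_le, Cmod_ge_0.
    + apply Rinv_le_contravar; lra.
    + apply pow_incr. split; auto using Cmod_ge_0.
Qed.

Lemma approx_qpinf q g : 0 < q < 1 -> approx q g -> approx q (fun z => qpinf q (g z)).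
Proof.
  intros Hq Hg. apply (approx_unif_cv q (fun n z => qp q (g z) n)).
  - induction n as [|n IH]; simpl; [apply approx_const|]. apply approx_mult; auto.
    apply (approx_ext q (fun z => 1 + RtoC (- q ^ n) * g z)%C).
    + intros z _. rewrite RtoC_opp. ring.
    + apply approx_plus; [apply approx_const|]. apply approx_mult; auto using approx_const.
  - apply unif_cv_qp; auto using bounded_on_approx.
Qed.

(** The bound [rho < 1] acts twice: it turns each [1 / (1 - q^n g)] into a geometric series, and it
    keeps the infinite product away from 0, so that the inverses converge uniformly. *)
Lemma approx_inv_qpinf q g rho : 0 < q < 1 -> approx q g -> 0 < rho < 1 ->
  (forall z, two_circles q z -> Cmod (g z) <= rho) -> approx q (fun z => / qpinf q (g z))%C.
Proof.
  intros Hq Hg Hr HB. apply (approx_unif_cv q (fun n z => / qp q (g z) n)%C).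
  - induction n as [|n IH]; simpl.
    + apply (approx_ext q (fun _ => RtoC 1)); [|apply approx_const]. intros; field.
    + assert (Hs : forall z, two_circles q z -> Cmod (RtoC (q ^ n) * g z) <= rho).
      { intros z Hz. specialize (HB z Hz). rewrite Cmod_mult, Cmod_R.
        destruct (pow_unit_interval q n Hq). rewrite Rabs_pos_eq by lra.
        pose proof (Cmod_ge_0 (g z)). nra. }
      apply (approx_ext q (fun z => / qp q (g z) n * / (1 - RtoC (q ^ n) * g z))%C).
      * intros z Hz. field. split.
        -- intros E. specialize (Hs z Hz).
           replace (RtoC (q ^ n) * g z)%C with (RtoC 1) in Hs.
           ++ rewrite Cmod_1 in Hs. lra.
           ++ replace (RtoC (q ^ n) * g z)%C with (1 - (1 - RtoC (q ^ n) * g z))%C by ring.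
              rewrite E. ring.
        -- apply qp_neq0; auto. specialize (HB z Hz). lra.
      * apply approx_mult; auto.
        apply (approx_geom q (fun z => RtoC (q ^ n) * g z)%C rho); auto.
        apply approx_mult; auto using approx_const.
  - apply unif_cv_inv; [apply unif_cv_qp; auto using bounded_on_approx|].
    apply (bounded_away_qpinf _ _ _ rho); auto; lra.
Qed.

(** * The Askey-Wilson integral *)

(** This is [h] at [cos t] in factored form (see [toC_h]); the factors in [e^(it)] and [e^(-it)] can
    then be shifted separately. *)
Definition hinf (q : R) (a : C) (t : R) : C := (qpinf q (a * ei t) * qpinf q (a * ei (- t)))%C.
Definition aw (q : R) (a b c d : C) (t : R) : C :=
  (qpinf q (ei (2 * t)) * qpinf q (ei (- (2 * t)))
   / (hinf q a t * hinf q b t * hinf q c t * hinf q d t))%C.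

Lemma ei_double t : ei (2 * t) = (ei t * ei t)%C.
Proof. rewrite <- ei_plus. f_equal. ring. Qed.

Lemma Cmod_mult_ei a t : Cmod (a * ei t) = Cmod a.
Proof. rewrite Cmod_mult, Cmod_ei. ring. Qed.

Lemma hinf_neq0 q a t : 0 < q < 1 -> Cmod a < 1 -> hinf q a t <> RtoC 0.
Proof. intros Hq Ha. apply Cmult_neq_0; apply qpinf_neq0; auto; rewrite Cmod_mult_ei; auto. Qed.

Lemma bounded_on_mult_ei {T} (D : T -> Prop) a (k : T -> R) : bounded_on D (fun x => a * ei (k x))%C.
Proof. exists (Cmod a). intros x _. rewrite Cmod_mult_ei. lra. Qed.

Lemma bounded_on_ei {T} (D : T -> Prop) (k : T -> R) : bounded_on D (fun x => ei (k x)).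
Proof. exists 1. intros x _. rewrite Cmod_ei. lra. Qed.

Lemma ccont_qpinf q f : 0 < q < 1 -> ccont f -> bounded_on (fun _ => True) f -> ccont (fun t => qpinf q (f t)).
Proof.
  intros Hq Hf Hb. apply (ccont_unif_cv (fun n t => qp q (f t) n)).
  - induction n as [|n IH]; simpl; [apply ccont_const|]. apply ccont_mult; auto.
    apply (ccont_ext (fun t => 1 + RtoC (- q ^ n) * f t)%C).
    + intros t. rewrite RtoC_opp. ring.
    + apply ccont_plus; [apply ccont_const|]. apply ccont_mult; auto using ccont_const.
  - apply unif_cv_qp; auto.
Qed.

Lemma ccont_ei_opp k : ccont (fun t => ei (- (k * t))).
Proof. apply (ccont_ext (fun t => ei (- k * t))); [|apply ccont_ei]. intros t; f_equal; ring. Qed.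

Lemma ccont_hinf q a : 0 < q < 1 -> ccont (hinf q a).
Proof.
  intros Hq. apply ccont_mult; apply ccont_qpinf; auto using bounded_on_mult_ei;
    apply ccont_mult; auto using ccont_const.
  - apply (ccont_ext (fun t => ei (1 * t))); [|apply ccont_ei]. intros; f_equal; ring.
  - apply (ccont_ext (fun t => ei (-1 * t))); [|apply ccont_ei]. intros; f_equal; ring.
Qed.

Lemma ccont_aw q a b c d : 0 < q < 1 -> Cmod a < 1 -> Cmod b < 1 -> Cmod c < 1 -> Cmod d < 1 ->
  ccont (aw q a b c d).
Proof.
  intros Hq Ha Hb Hc Hd. apply ccont_mult.
  - apply ccont_mult; apply ccont_qpinf; auto using bounded_on_ei, ccont_ei, ccont_ei_opp.
  - apply ccont_inv.
    + do 3 (apply ccont_mult; [|apply ccont_hinf; auto]). apply ccont_hinf; auto.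
    + intros t. do 3 (apply Cmult_neq_0; [|apply hinf_neq0; auto]). apply hinf_neq0; auto.
Qed.

Lemma bounded_away_hinf q a : 0 < q < 1 -> Cmod a < 1 -> bounded_away (fun _ => True) (hinf q a).
Proof.
  intros Hq Ha. apply bounded_away_mult;
    apply (bounded_away_qpinf _ q _ (Cmod a)); auto; intros; rewrite Cmod_mult_ei; lra.
Qed.

Lemma bounded_on_aw q a b c d : 0 < q < 1 -> Cmod a < 1 -> Cmod b < 1 -> Cmod c < 1 -> Cmod d < 1 ->
  bounded_on (fun _ => True) (aw q a b c d).
Proof.
  intros Hq Ha Hb Hc Hd. apply bounded_on_mult.
  - apply bounded_on_mult; apply bounded_on_qpinf; auto using bounded_on_ei.
  - apply bounded_on_inv. do 3 (apply bounded_away_mult; [|apply bounded_away_hinf; auto]). apply bounded_away_hinf; auto.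
Qed.

Lemma hinf_even q a t : hinf q a (- t) = hinf q a t.
Proof. unfold hinf. rewrite Ropp_involutive. ring. Qed.

Lemma aw_even q a b c d t : aw q a b c d (- t) = aw q a b c d t.
Proof.
  unfold aw. rewrite !hinf_even. replace (2 * - t) with (- (2 * t)) by ring.
  rewrite Ropp_involutive. unfold Cdiv. ring.
Qed.

(* With [Delta] the weight [aw] as a function of [z = e^(it)], this is
   [Delta(z) prod_j (z - t_j) / (z (1 - z^2))] after cancellation: it has no pole in
   [q <= |z| <= 1], since the poles of [Delta] at [t_j] are removed. *)
Definition contour (q : R) (a b c d z : C) : C :=
  (z ^ 3 * qpinf q (RtoC q * z ^ 2) * qpinf q ((/ z) ^ 2)
   * (/ qpinf q (a * z) * / qpinf q (RtoC q * a * / z))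
   * (/ qpinf q (b * z) * / qpinf q (RtoC q * b * / z))
   * (/ qpinf q (c * z) * / qpinf q (RtoC q * c * / z))
   * (/ qpinf q (d * z) * / qpinf q (RtoC q * d * / z)))%C.

Lemma approx_z q : approx q (fun z => z).
Proof. apply (approx_ext q (fun z => z ^ 1)%C); [intros; simpl; ring | apply approx_pow]. Qed.

Lemma approx_inv_z q : approx q (fun z => / z)%C.
Proof. apply (approx_ext q (fun z => (/ z) ^ 1)%C); [intros; simpl; ring | apply approx_inv_pow]. Qed.

(** On [q <= |z| <= 1] both [|a z|] and [|q a / z|] are at most [|a| < 1]. The extra [q] in the
    second argument removes the factor [1 - a / z], whose zero may lie in the annulus. *)
Lemma approx_contour_factor q a : 0 < q < 1 -> Cmod a < 1 ->
  approx q (fun z => / qpinf q (a * z) * / qpinf q (RtoC q * a * / z))%C.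
Proof.
  intros Hq Ha. pose proof (Cmod_ge_0 a).
  assert (Hz : forall z, two_circles q z -> q <= Cmod z <= 1)
    by (intros z [E|E]; rewrite E; lra).
  apply approx_mult; auto;
    (* The midpoint [(1 + |a|) / 2] replaces [|a|] because the bound must be positive also for
       [a = 0]. *)
    apply (approx_inv_qpinf q _ ((1 + Cmod a) / 2)); auto; try lra.
  - apply approx_mult; auto using approx_const, approx_z.
  - intros z Hz'. specialize (Hz z Hz'). rewrite Cmod_mult. nra.
  - apply approx_mult; auto using approx_const, approx_inv_z.
  - intros z Hz'. specialize (Hz z Hz').
    rewrite !Cmod_mult, Cmod_R, Rabs_pos_eq, Cmod_inv
      by (try lra; apply (two_circles_neq0 q); auto; lra).
    assert (q * / Cmod z <= 1).
    { apply Rmult_le_reg_r with (Cmod z); [lra|]. rewrite Rmult_assoc, Rinv_l; lra. }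
    assert (0 < / Cmod z) by (apply Rinv_0_lt_compat; lra).
    replace (q * Cmod a * / Cmod z) with (Cmod a * (q * / Cmod z)) by ring. nra.
Qed.

Lemma approx_contour q a b c d :
  0 < q < 1 -> Cmod a < 1 -> Cmod b < 1 -> Cmod c < 1 -> Cmod d < 1 ->
  approx q (contour q a b c d).
Proof.
  intros Hq Ha Hb Hc Hd. unfold contour.
  repeat (apply approx_mult; [assumption| |apply approx_contour_factor; assumption]).
  apply approx_mult; [assumption| |apply approx_qpinf; auto using approx_inv_pow].
  apply approx_mult; [assumption|apply approx_pow|apply approx_qpinf; auto].
  apply approx_mult; auto using approx_const, approx_pow.
Qed.

Lemma one_minus_neq0 x : Cmod x < 1 -> (1 - x)%C <> RtoC 0.
Proof.
  intros Hx E. replace x with (1 - (1 - x))%C in Hx by ring. rewrite E in Hx.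
  replace (1 - 0)%C with (RtoC 1) in Hx by ring. rewrite Cmod_1 in Hx. lra.
Qed.

(** With [t_j] the parameters and [e_k] their elementary symmetric polynomials, [contour] at [qz]
    equals [Delta(z) prod_j (1 - t_j z) / (z (1 - z^2))]. The difference of the two products is
    [(z^2 - 1) ((1 - e_4) (z^2 + 1) - (e_1 - e_3) z)]: the term in [e_2] drops out and [1 - z^2]
    cancels. *)
Lemma contour_diff q a b c d t :
  0 < q < 1 -> Cmod a < 1 -> Cmod b < 1 -> Cmod c < 1 -> Cmod d < 1 ->
  (contour q a b c d (ei t) - contour q a b c d (RtoC q * ei t))%C =
  (aw q a b c d t * ((a + b + c + d - (a * b * c + a * b * d + a * c * d + b * c * d))
     - (1 - a * b * c * d) * (ei t + / ei t)))%C.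
Proof.
  intros Hq Ha Hb Hc Hd. unfold contour, aw, hinf.
  rewrite ei_opp, ei_double, !ei_opp.
  assert (Hz := ei_neq0 t). assert (Hz1 := Cmod_ei t). set (z := ei t) in *. clearbody z.
  assert (Hq0 : RtoC q <> RtoC 0) by (apply RtoC_neq0; lra).
  assert (Hzi : Cmod (/ z) = 1) by (rewrite Cmod_inv, Hz1 by auto; field).
  assert (Hqm : Cmod (RtoC q) = q) by (rewrite Cmod_R, Rabs_pos_eq; lra).
  assert (F1 : forall u, Cmod u < 1 -> (1 - u * z)%C <> RtoC 0).
  { intros u Hu. apply one_minus_neq0. rewrite Cmod_mult, Hz1. lra. }
  assert (F2 : forall u, Cmod u < 1 -> (z - u)%C <> RtoC 0).
  { intros u Hu. replace (z - u)%C with (z * (1 - u * / z))%C by (field; auto).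
    apply Cmult_neq_0; auto. apply one_minus_neq0. rewrite Cmod_mult, Hzi. lra. }
  assert (G1 : forall u, qpinf q (u * z) = ((1 - u * z) * qpinf q (RtoC q * (u * z)))%C)
    by (intros; apply qpinf_step; auto).
  assert (G2 : forall u, qpinf q (u * / z) = ((1 - u * / z) * qpinf q (RtoC q * (u * / z)))%C)
    by (intros; apply qpinf_step; auto).
  assert (G3 : forall u, Cmod u < 1 -> qpinf q (RtoC q * (u * z)) <> RtoC 0).
  { intros u Hu. apply qpinf_neq0; auto. rewrite !Cmod_mult, Hqm, Hz1. pose proof (Cmod_ge_0 u). nra. }
  assert (G4 : forall u, Cmod u < 1 -> qpinf q (RtoC q * (u * / z)) <> RtoC 0).
  { intros u Hu. apply qpinf_neq0; auto. rewrite !Cmod_mult, Hqm, Hzi. pose proof (Cmod_ge_0 u). nra. }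
  (* The weight, [contour] at [z] and [contour] at [qz] involve this product from [z^2], [q z^2] and
     [q^3 z^2] on. Written over the common tails [X] and [Y], the claim becomes a rational identity;
     it has no denominator [1 - z^2], so [z = 1] and [z = -1] are not exceptional. *)
  set (X := qpinf q (RtoC q * (RtoC q * (RtoC q * (z * z))))).
  assert (E1 : qpinf q (RtoC q * z ^ 2) =
    ((1 - RtoC q * (z * z)) * ((1 - RtoC q * (RtoC q * (z * z))) * X))%C).
  { replace (RtoC q * z ^ 2)%C with (RtoC q * (z * z))%C by (simpl; ring).
    rewrite qpinf_step, (qpinf_step q (RtoC q * (RtoC q * (z * z)))) by auto. reflexivity. }
  assert (E0 : qpinf q (z * z) =
    ((1 - z * z) * ((1 - RtoC q * (z * z)) * ((1 - RtoC q * (RtoC q * (z * z))) * X)))%C).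
  { rewrite qpinf_step by auto. f_equal. rewrite <- E1. f_equal. simpl; ring. }
  assert (E2 : qpinf q (RtoC q * (RtoC q * z) ^ 2) = X) by (unfold X; f_equal; simpl; ring).
  set (Y := qpinf q ((/ z) ^ 2)).
  assert (E3 : qpinf q (/ (z * z)) = Y) by (unfold Y; f_equal; simpl; field; auto).
  assert (E4 : qpinf q ((/ (RtoC q * z)) ^ 2) =
    ((1 - / (RtoC q * RtoC q * (z * z))) * ((1 - / (RtoC q * (z * z))) * Y))%C).
  { replace ((/ (RtoC q * z)) ^ 2)%C with (/ (RtoC q * RtoC q * (z * z)))%C by (simpl; field; auto).
    rewrite qpinf_step by auto. f_equal.
    replace (RtoC q * / (RtoC q * RtoC q * (z * z)))%C with (/ (RtoC q * (z * z)))%C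
      by (field; auto).
    rewrite qpinf_step by auto. f_equal. unfold Y. f_equal. simpl; field; auto. }
  rewrite E0, E1, E2, E3, E4. clear E0 E1 E2 E3 E4. clearbody X Y.
  assert (R1 : forall u, (u * (RtoC q * z))%C = (RtoC q * (u * z))%C) by (intros; ring).
  assert (R2 : forall u, (RtoC q * u * / z)%C = (RtoC q * (u * / z))%C) by (intros; ring).
  assert (R3 : forall u, (RtoC q * u * / (RtoC q * z))%C = (u * / z)%C) by (intros; field; auto).
  rewrite !R1, !R2, !R3.
  rewrite (G1 a), (G1 b), (G1 c), (G1 d), (G2 a), (G2 b), (G2 c), (G2 d).
  generalize (F1 a Ha) (F1 b Hb) (F1 c Hc) (F1 d Hd) (F2 a Ha) (F2 b Hb) (F2 c Hc) (F2 d Hd)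
    (G3 a Ha) (G3 b Hb) (G3 c Hc) (G3 d Hd) (G4 a Ha) (G4 b Hb) (G4 c Hc) (G4 d Hd).
  generalize (qpinf q (RtoC q * (a * z))) (qpinf q (RtoC q * (b * z)))
    (qpinf q (RtoC q * (c * z))) (qpinf q (RtoC q * (d * z)))
    (qpinf q (RtoC q * (a * / z))) (qpinf q (RtoC q * (b * / z)))
    (qpinf q (RtoC q * (c * / z))) (qpinf q (RtoC q * (d * / z))).
  clear - Hz Hq0. intros A1 B1 C1 D1 A2 B2 C2 D2. intros. field.
  repeat split; auto.
Qed.

Lemma Cmod_qmult_lt1 q a : 0 < q < 1 -> Cmod a < 1 -> Cmod (RtoC q * a) < 1.
Proof.
  intros Hq Ha. rewrite Cmod_mult, Cmod_R, Rabs_pos_eq by lra. pose proof (Cmod_ge_0 a). nra.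
Qed.

Lemma Cmod_qpow_mult_lt1 q a n : 0 < q < 1 -> Cmod a < 1 -> Cmod (RtoC (q ^ n) * a) < 1.
Proof.
  intros Hq Ha. destruct (pow_unit_interval q n Hq).
  rewrite Cmod_mult, Cmod_R, Rabs_pos_eq by lra. pose proof (Cmod_ge_0 a). nra.
Qed.

Lemma Cmod_mult_lt1 a b : Cmod a < 1 -> Cmod b < 1 -> Cmod (a * b) < 1.
Proof.
  intros Ha Hb. rewrite Cmod_mult. pose proof (Cmod_ge_0 a). pose proof (Cmod_ge_0 b). nra.
Qed.

Lemma ccont_ei_1 : ccont ei.
Proof. apply (ccont_ext (fun t => ei (1 * t))); [|apply ccont_ei]. intros; f_equal; ring. Qed.

Lemma ccont_2cos : ccont (fun t => ei t + / ei t)%C.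
Proof. apply ccont_plus; [|apply ccont_inv]; auto using ccont_ei_1, ei_neq0. Qed.

(** * The first moment and the contiguous relation *)

Definition awI (q : R) (a b c d : C) : C := CI (aw q a b c d) (- PI) PI.

(** This is [contour_diff] integrated over the circle, where the left side vanishes by
    [CI_approx]. *)
Lemma aw_moment q a b c d :
  0 < q < 1 -> Cmod a < 1 -> Cmod b < 1 -> Cmod c < 1 -> Cmod d < 1 ->
  ((1 - a * b * c * d) * CI (fun t => aw q a b c d t * (ei t + / ei t)) (- PI) PI)%C =
  ((a + b + c + d - (a * b * c + a * b * d + a * c * d + b * c * d)) * awI q a b c d)%C.
Proof.
  intros Hq Ha Hb Hc Hd.
  destruct (CI_approx q _ Hq (approx_contour q a b c d Hq Ha Hb Hc Hd)) as [C1 [Cq E]].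
  assert (Hw := ccont_aw q a b c d Hq Ha Hb Hc Hd).
  assert (Hm : ccont (fun t => aw q a b c d t * (ei t + / ei t))%C)
    by (apply ccont_mult; auto using ccont_2cos).
  set (s := (a + b + c + d - (a * b * c + a * b * d + a * c * d + b * c * d))%C).
  (* The pointwise premise is left open so that linearity can be applied to the conclusion first;
     [contour_diff] discharges it in [E3]. *)
  assert (E2 := CI_ext
    (fun t => contour q a b c d (ei t) + - (1) * contour q a b c d (RtoC q * ei t))%C
    (fun t => s * aw q a b c d t
      + (- (1 - a * b * c * d)) * (aw q a b c d t * (ei t + / ei t)))%C (- PI) PI).
  rewrite !CI_plus, !CI_scal, E in E2
    by (try assumption; apply ccont_mult; auto using ccont_const).
  fold (awI q a b c d) in E2.
  set (m := CI (fun t => aw q a b c d t * (ei t + / ei t))%C (- PI) PI) in *.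
  assert (E3 : (s * awI q a b c d + - (1 - a * b * c * d) * m)%C = RtoC 0).
  { rewrite <- E2; [ring|]. intros t.
    transitivity (contour q a b c d (ei t) - contour q a b c d (RtoC q * ei t))%C; [ring|].
    rewrite contour_diff by auto. fold s. ring. }
  replace (s * awI q a b c d)%C with
    ((s * awI q a b c d + - (1 - a * b * c * d) * m) + (1 - a * b * c * d) * m)%C by ring.
  rewrite E3. ring.
Qed.

Lemma hinf_shift q a n t : 0 < q < 1 ->
  hinf q a t = (qp q (a * ei t) n * qp q (a * ei (- t)) n * hinf q (RtoC (q ^ n) * a) t)%C.
Proof.
  intros Hq. unfold hinf.
  rewrite (qpinf_shift q (a * ei t) n Hq), (qpinf_shift q (a * ei (- t)) n Hq).
  rewrite !Cmult_assoc. ring.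
Qed.

Lemma aw_shift q a b c d n t :
  0 < q < 1 -> Cmod a < 1 -> Cmod b < 1 -> Cmod c < 1 -> Cmod d < 1 ->
  aw q (RtoC (q ^ n) * a) b c d t = (aw q a b c d t * (qp q (a * ei t) n * qp q (a * ei (- t)) n))%C.
Proof.
  intros Hq Ha Hb Hc Hd. unfold aw. rewrite (hinf_shift q a n t Hq).
  assert (H1 := hinf_neq0 q b t Hq Hb). assert (H2 := hinf_neq0 q c t Hq Hc).
  assert (H3 := hinf_neq0 q d t Hq Hd).
  assert (H4 := hinf_neq0 q (RtoC (q ^ n) * a) t Hq (Cmod_qpow_mult_lt1 q a n Hq Ha)).
  assert (H5 : qp q (a * ei t) n <> RtoC 0) by (apply qp_neq0; auto; rewrite Cmod_mult_ei; auto).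
  assert (H6 : qp q (a * ei (- t)) n <> RtoC 0) by (apply qp_neq0; auto; rewrite Cmod_mult_ei; auto).
  field. repeat split; auto.
Qed.

(** Since [(1 - a z) (1 - a / z) = 1 + a^2 - a (z + 1/z)], the shifted integral is a combination of
    [awI] and the moment. What remains is [(1 - e_4) (1 + a^2) - a (e_1 - e_3) = (1 - ab) (1 - ac)
    (1 - ad)]. *)
Lemma awI_step q a b c d :
  0 < q < 1 -> Cmod a < 1 -> Cmod b < 1 -> Cmod c < 1 -> Cmod d < 1 ->
  (awI q a b c d * ((1 - a * b) * (1 - a * c) * (1 - a * d)))%C =
  ((1 - a * b * c * d) * awI q (RtoC q * a) b c d)%C.
Proof.
  intros Hq Ha Hb Hc Hd.
  assert (Hw := ccont_aw q a b c d Hq Ha Hb Hc Hd).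
  assert (Hm : ccont (fun t => aw q a b c d t * (ei t + / ei t))%C)
    by (apply ccont_mult; auto using ccont_2cos).
  assert (M := aw_moment q a b c d Hq Ha Hb Hc Hd).
  assert (E : awI q (RtoC q * a) b c d = ((1 + a * a) * awI q a b c d
      + - a * CI (fun t => aw q a b c d t * (ei t + / ei t)) (- PI) PI)%C).
  { unfold awI. rewrite <- !CI_scal, <- CI_plus
      by (try assumption; apply ccont_mult; auto using ccont_const).
    apply CI_ext. intros t. assert (Es := aw_shift q a b c d 1 t Hq Ha Hb Hc Hd).
    rewrite pow_1 in Es. rewrite Es. simpl qp. simpl pow. rewrite ei_opp. field. apply ei_neq0. }
  rewrite E. set (m := CI _ _ _) in *.
  replace ((1 - a * b * c * d) * ((1 + a * a) * awI q a b c d + - a * m))%C with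
    ((1 - a * b * c * d) * (1 + a * a) * awI q a b c d - a * ((1 - a * b * c * d) * m))%C by ring.
  rewrite M. ring.
Qed.

Lemma awI_iter q a b c d n :
  0 < q < 1 -> Cmod a < 1 -> Cmod b < 1 -> Cmod c < 1 -> Cmod d < 1 ->
  (awI q a b c d * (qp q (a * b) n * qp q (a * c) n * qp q (a * d) n))%C =
  (qp q (a * b * c * d) n * awI q (RtoC (q ^ n) * a) b c d)%C.
Proof.
  intros Hq Ha Hb Hc Hd. induction n as [|n IH].
  - simpl. rewrite !Cmult_1_l. ring.
  - simpl qp. assert (Hs := awI_step q (RtoC (q ^ n) * a) b c d Hq
      (Cmod_qpow_mult_lt1 q a n Hq Ha) Hb Hc Hd).
    replace (RtoC (q ^ S n) * a)%C with (RtoC q * (RtoC (q ^ n) * a))%C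
      by (simpl; rewrite RtoC_mult; ring).
    transitivity ((awI q a b c d * (qp q (a * b) n * qp q (a * c) n * qp q (a * d) n)) *
      ((1 - RtoC (q ^ n) * a * b) * (1 - RtoC (q ^ n) * a * c) * (1 - RtoC (q ^ n) * a * d)))%C; [ring|].
    rewrite IH, <- (Cmult_assoc (qp q _ n)), Hs. ring.
Qed.

(** By [aw_shift] the index [n] occurs only in finite products. Their limit is [hinf q a], which
    cancels the factor of [a] in the weight and leaves the weight with that parameter 0. *)
Lemma unif_cv_aw_qp q a b c d :
  0 < q < 1 -> Cmod a < 1 -> Cmod b < 1 -> Cmod c < 1 -> Cmod d < 1 ->
  unif_cv (fun _ => True) (fun n => aw q (RtoC (q ^ n) * a) b c d) (aw q (RtoC 0) b c d).
Proof.
  intros Hq Ha Hb Hc Hd.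
  assert (U : unif_cv (fun _ => True)
     (fun n t => aw q a b c d t * (qp q (a * ei t) n * qp q (a * ei (- t)) n))%C
     (fun t => aw q a b c d t * (qpinf q (a * ei t) * qpinf q (a * ei (- t))))%C).
  { apply (unif_cv_mult _ (fun _ => aw q a b c d) (aw q a b c d)
      (fun n t => qp q (a * ei t) n * qp q (a * ei (- t)) n)%C
      (fun t => qpinf q (a * ei t) * qpinf q (a * ei (- t)))%C).
    - apply unif_cv_const.
    - apply (unif_cv_mult _ (fun n t => qp q (a * ei t) n) (fun t => qpinf q (a * ei t))
        (fun n t => qp q (a * ei (- t)) n) (fun t => qpinf q (a * ei (- t))));
        [apply unif_cv_qp | apply unif_cv_qp | apply bounded_on_qpinf | apply bounded_on_qpinf];
        auto using bounded_on_mult_ei.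
    - apply bounded_on_aw; auto.
    - apply (bounded_on_mult _ (fun t => qpinf q (a * ei t)) (fun t => qpinf q (a * ei (- t))));
        apply bounded_on_qpinf; auto using bounded_on_mult_ei. }
  intros eps He. destruct (U eps He) as [N HN]. exists N. intros n Hn t Ht.
  specialize (HN n Hn t Ht).
  rewrite aw_shift by auto.
  replace (aw q (RtoC 0) b c d t) with
    (aw q a b c d t * (qpinf q (a * ei t) * qpinf q (a * ei (- t))))%C; auto.
  fold (hinf q a t). unfold aw.
  replace (hinf q (RtoC 0) t) with (RtoC 1).
  - assert (H1 := hinf_neq0 q b t Hq Hb). assert (H2 := hinf_neq0 q c t Hq Hc).
    assert (H3 := hinf_neq0 q d t Hq Hd). assert (H4 := hinf_neq0 q a t Hq Ha).
    field. repeat split; auto.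
  - unfold hinf. rewrite !Cmult_0_l, qpinf_0 by auto. ring.
Qed.

Lemma awI_reduce q a b c d :
  0 < q < 1 -> Cmod a < 1 -> Cmod b < 1 -> Cmod c < 1 -> Cmod d < 1 ->
  (awI q a b c d * (qpinf q (a * b) * qpinf q (a * c) * qpinf q (a * d)))%C =
  (qpinf q (a * b * c * d) * awI q (RtoC 0) b c d)%C.
Proof.
  intros Hq Ha Hb Hc Hd. pose proof PI_RGT_0.
  apply (ccv_unique (fun n => awI q a b c d *
           (qp q (a * b) n * qp q (a * c) n * qp q (a * d) n))%C).
  - apply ccv_mult; [apply ccv_const|].
    apply ccv_mult; [apply ccv_mult|]; apply ccv_qp; auto.
  - eapply ccv_ext; [intros n; symmetry; apply awI_iter; auto|].
    apply ccv_mult; [apply ccv_qp; auto|].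
    apply ccv_CI; [lra| |apply unif_cv_aw_qp; auto].
    intros n. apply ccont_aw; auto. apply Cmod_qpow_mult_lt1; auto.
Qed.

Lemma aw_perm q a b c d t : aw q a b c d t = aw q b c d a t.
Proof. unfold aw. f_equal. ring. Qed.

Lemma awI_perm q a b c d : awI q a b c d = awI q b c d a.
Proof. apply CI_ext. apply aw_perm. Qed.

(** Each reduction replaces one parameter by 0 and collects its products with the remaining ones.
    Arguments containing a 0 contribute 1, so [(abcd; q)] arises from the first reduction only. *)
Lemma awI_reduce_all q a b c d :
  0 < q < 1 -> Cmod a < 1 -> Cmod b < 1 -> Cmod c < 1 -> Cmod d < 1 ->
  (awI q a b c d * (qpinf q (a * b) * qpinf q (a * c) * qpinf q (a * d)
                    * qpinf q (b * c) * qpinf q (b * d) * qpinf q (c * d)))%C =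
  (qpinf q (a * b * c * d) * awI q (RtoC 0) (RtoC 0) (RtoC 0) (RtoC 0))%C.
Proof.
  intros Hq Ha Hb Hc Hd.
  assert (H0 : Cmod (RtoC 0) < 1) by (rewrite Cmod_0; lra).
  assert (Ea := awI_reduce q a b c d Hq Ha Hb Hc Hd).
  assert (Eb := awI_reduce q b c d (RtoC 0) Hq Hb Hc Hd H0).
  assert (Ec := awI_reduce q c d (RtoC 0) (RtoC 0) Hq Hc Hd H0 H0).
  assert (Ed := awI_reduce q d (RtoC 0) (RtoC 0) (RtoC 0) Hq Hd H0 H0 H0).
  (* After this rotation the left integral of each equation is the right integral of the preceding
     one. *)
  rewrite <- awI_perm in Eb, Ec, Ed.
  rewrite ?Cmult_0_r, ?Cmult_0_l, ?qpinf_0, ?Cmult_1_l, ?Cmult_1_r in Eb, Ec, Ed by auto.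
  transitivity ((awI q a b c d * (qpinf q (a * b) * qpinf q (a * c) * qpinf q (a * d)))
    * (qpinf q (b * c) * qpinf q (b * d)) * qpinf q (c * d))%C; [ring|].
  rewrite Cmult_1_r, Cmult_1_l in Ed. rewrite Ea, <- Ed, <- Ec, <- Eb. ring.
Qed.

(* Parameters [q, -q, s, -s] with [s ^ 2 = q] collapse the weight to [(1 - z^2)(1 - z^-2)]. *)
Lemma aw_explicit s t : 0 < s < 1 ->
  let q := s * s in
  aw q (RtoC q) (- RtoC q) (RtoC s) (- RtoC s) t =
  ((1 - ei (2 * t)) * (1 - ei (-2 * t)))%C.
Proof.
  intros Hs q. assert (Hq : 0 < q < 1) by (unfold q; nra).
  unfold aw, hinf.
  assert (E : forall u, qpinf q (ei u * ei u) =
     ((1 - ei u * ei u) * (qpinf q (RtoC q * ei u) * qpinf q (- RtoC q * ei u)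
       * qpinf q (RtoC s * ei u) * qpinf q (- RtoC s * ei u)))%C).
  { intros u. unfold q. rewrite (qpinf_square s (ei u) Hs). fold q.
    rewrite (qpinf_step q (ei u) Hq), (qpinf_step q (- ei u) Hq).
    replace (RtoC q * - ei u)%C with (- RtoC q * ei u)%C by ring.
    replace (- (RtoC s * ei u))%C with (- RtoC s * ei u)%C by ring. ring. }
  replace (ei (- (2 * t))) with (ei (- t) * ei (- t))%C by (rewrite <- ei_plus; f_equal; ring).
  replace (ei (-2 * t)) with (ei (- t) * ei (- t))%C by (rewrite <- ei_plus; f_equal; ring).
  rewrite ei_double, !E.
  assert (Hn : forall u v, Cmod v < 1 -> qpinf q (v * ei u) <> RtoC 0)
    by (intros; apply qpinf_neq0; auto; rewrite Cmod_mult_ei; auto).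
  assert (Cmod (RtoC q) < 1) by (rewrite Cmod_R, Rabs_pos_eq; lra).
  assert (Cmod (- RtoC q) < 1) by (rewrite Cmod_opp; auto).
  assert (Cmod (RtoC s) < 1) by (rewrite Cmod_R, Rabs_pos_eq; lra).
  assert (Cmod (- RtoC s) < 1) by (rewrite Cmod_opp; auto).
  field. repeat split; apply Hn; auto.
Qed.

Lemma awI_explicit s : 0 < s < 1 ->
  let q := s * s in
  awI q (RtoC q) (- RtoC q) (RtoC s) (- RtoC s) = RtoC (4 * PI).
Proof.
  intros Hs q. unfold awI.
  (* The weight expands to [2 - e^(2it) - e^(-2it)]; the constant is written with frequency 0 so
     that all three terms have the same shape, and it alone survives. *)
  rewrite (CI_ext _ (fun t => RtoC 2 * ei (0 * t) + (- (1) * ei (2 * t) + - (1) * ei (-2 * t)))%C).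
  - assert (Hc : forall c k, ccont (fun t => c * ei (k * t))%C)
      by (intros; apply ccont_mult; [apply ccont_const | apply ccont_ei]).
    rewrite (CI_plus _ _ _ _ (Hc _ 0) (ccont_plus _ _ (Hc _ 2) (Hc _ (-2)))).
    rewrite (CI_plus _ _ _ _ (Hc _ 2) (Hc _ (-2))).
    rewrite (CI_scal _ _ _ _ (ccont_ei 0)), (CI_scal _ _ _ _ (ccont_ei 2)),
      (CI_scal _ _ _ _ (ccont_ei (-2))).
    rewrite (CI_ei 2), (CI_ei (-2)); try lra.
    + rewrite (CI_ext _ (fun _ => RtoC 1)) by (intros; rewrite Rmult_0_l; apply ei_0).
      unfold CI; simpl. rewrite !RInt_const.
      apply injective_projections; simpl; unfold scal; simpl; unfold mult; simpl; ring.
    + replace (-2 * PI) with (- (2 * PI)) by ring. rewrite sin_neg, sin_2PI; ring.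
    + apply sin_2PI.
  - intros t. unfold q. rewrite aw_explicit by auto. rewrite Rmult_0_l, ei_0.
    assert (E : (ei (2 * t) * ei (-2 * t))%C = RtoC 1).
    { rewrite <- ei_plus. replace (2 * t + -2 * t) with 0 by ring. apply ei_0. }
    transitivity (1 - ei (2 * t) - ei (-2 * t) + ei (2 * t) * ei (-2 * t))%C; [ring|].
    rewrite E. ring.
Qed.

(* Comparing [awI_reduce_all] with [awI_explicit] leaves Euler's identity
   [(-q; q) (q; q^2) = 1], which is [qpinf_square] at [x = s]. *)
Lemma awI_0 q : 0 < q < 1 ->
  (awI q (RtoC 0) (RtoC 0) (RtoC 0) (RtoC 0) * qpinf q (RtoC q))%C = RtoC (4 * PI).
Proof.
  intros Hq0. set (s := sqrt q).
  assert (Es : s * s = q) by (apply sqrt_sqrt; lra).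
  assert (Hs : 0 < s < 1).
  { split; [apply sqrt_lt_R0; lra|]. rewrite <- sqrt_1. apply sqrt_lt_1; lra. }
  rewrite <- Es. set (Q := s * s). assert (Hq : 0 < Q < 1) by (unfold Q; rewrite Es; auto).
  assert (Hc1 : Cmod (RtoC Q) < 1) by (rewrite Cmod_R, Rabs_pos_eq; lra).
  assert (Hc2 : Cmod (- RtoC Q) < 1) by (rewrite Cmod_opp; auto).
  assert (Hc3 : Cmod (RtoC s) < 1) by (rewrite Cmod_R, Rabs_pos_eq; lra).
  assert (Hc4 : Cmod (- RtoC s) < 1) by (rewrite Cmod_opp; auto).
  assert (H := awI_reduce_all Q _ _ _ _ Hq Hc1 Hc2 Hc3 Hc4).
  assert (Hv := awI_explicit s Hs). simpl in Hv. fold Q in Hv. rewrite Hv in H.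
  clear Hv.
  set (I0 := awI Q (RtoC 0) (RtoC 0) (RtoC 0) (RtoC 0)) in *.
  assert (EQ : RtoC Q = (RtoC s * RtoC s)%C) by apply RtoC_mult.
  set (P := qpinf Q) in *.
  assert (Step : forall x, P x = ((1 - x) * P (RtoC Q * x))%C) by (intros; apply qpinf_step; auto).
  assert (Sq : P (RtoC s * RtoC s)%C = (P (RtoC s) * P (- RtoC s) * P (RtoC s * RtoC s) * P (- (RtoC s * RtoC s)))%C)
    by apply (qpinf_square s (RtoC s) Hs).
  assert (Nz : forall x, Cmod x < 1 -> P x <> RtoC 0) by (intros; apply qpinf_neq0; auto).
  rewrite <- EQ in Sq.
  assert (Eu : (P (RtoC s) * P (- RtoC s) * P (- RtoC Q))%C = RtoC 1).
  { replace (P (RtoC s) * P (- RtoC s) * P (- RtoC Q))%C with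
      (/ P (RtoC Q) * (P (RtoC s) * P (- RtoC s) * P (RtoC Q) * P (- RtoC Q)))%C
      by (field; auto).
    rewrite <- Sq. field. auto. }
  (* The pairwise products of the parameters are [-Q^2, Qs, -Qs, -Qs, Qs, -Q] and the product of all
     four is [Q^3]. As [P (-Q) = (1 + Q) D], [H] becomes [4 PI (1 + Q) (A B D)^2 = E I0], and [Eu]
     determines [A B D]. *)
  set (A := P (RtoC Q * RtoC s)%C).
  set (B := P (- (RtoC Q * RtoC s))%C).
  set (D := P (RtoC Q * - RtoC Q)%C) in *.
  set (E := P (RtoC Q * (RtoC Q * RtoC Q))%C).
  rewrite (Step (RtoC s)), (Step (- RtoC s)%C), (Step (- RtoC Q)%C) in Eu.
  replace (RtoC Q * - RtoC s)%C with (- (RtoC Q * RtoC s))%C in Eu by ring.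
  fold A B D in Eu.
  assert (EPQ : P (RtoC Q) = ((1 - RtoC Q) * ((1 - RtoC Q * RtoC Q) * E))%C)
    by (rewrite Step, (Step (RtoC Q * RtoC Q)%C); reflexivity).
  replace (P (RtoC Q * RtoC s)%C) with A in H by reflexivity.
  replace (RtoC Q * - RtoC s)%C with (- (RtoC Q * RtoC s))%C in H by ring.
  replace (- RtoC Q * RtoC s)%C with (- (RtoC Q * RtoC s))%C in H by ring.
  replace (- RtoC Q * - RtoC s)%C with (RtoC Q * RtoC s)%C in H by ring.
  replace (RtoC s * - RtoC s)%C with (- RtoC Q)%C in H by (rewrite EQ; ring).
  replace (RtoC Q * - RtoC Q * RtoC s * - RtoC s)%C with (RtoC Q * (RtoC Q * RtoC Q))%C in H
    by (rewrite !EQ; ring).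
  rewrite (Step (- RtoC Q)%C) in H. fold A B D E in H.
  rewrite EPQ.
  assert (N1 : (1 - RtoC Q)%C <> RtoC 0) by (apply one_minus_neq0; auto).
  assert (N2 : (1 - - RtoC Q)%C <> RtoC 0) by (apply one_minus_neq0; auto).
  assert (Eu2 : ((1 - RtoC Q) * (1 - - RtoC Q) * (A * B * D))%C = RtoC 1).
  { etransitivity; [|exact Eu]. rewrite EQ at 1. ring. }
  assert (X : (A * B * D)%C = (/ ((1 - RtoC Q) * (1 - - RtoC Q)))%C).
  { replace (A * B * D)%C with (/ ((1 - RtoC Q) * (1 - - RtoC Q)) *
      ((1 - RtoC Q) * (1 - - RtoC Q) * (A * B * D)))%C by (field; auto).
    rewrite Eu2. ring. }
  assert (Z : (E * I0)%C = (RtoC (4 * PI) * ((1 - - RtoC Q) * ((A * B * D) * (A * B * D))))%C)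
    by (rewrite <- H; ring).
  transitivity ((1 - RtoC Q) * (1 - RtoC Q * RtoC Q) * (E * I0))%C; [ring|].
  rewrite Z, X. field. auto.
Qed.

Lemma askey_wilson q a b c d :
  0 < q < 1 -> Cmod a < 1 -> Cmod b < 1 -> Cmod c < 1 -> Cmod d < 1 ->
  (CI (aw q a b c d) 0 PI * (qpinf q (RtoC q) * qpinf q (a * b) * qpinf q (a * c) * qpinf q (a * d)
                    * qpinf q (b * c) * qpinf q (b * d) * qpinf q (c * d)))%C =
  (RtoC (2 * PI) * qpinf q (a * b * c * d))%C.
Proof.
  intros Hq Ha Hb Hc Hd.
  assert (H := awI_reduce_all q a b c d Hq Ha Hb Hc Hd). assert (H0 := awI_0 q Hq).
  unfold awI at 1 in H. rewrite CI_even in H by (auto using ccont_aw, aw_even).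
  set (I0 := awI q _ _ _ _) in *.
  transitivity (/ RtoC 2 * qpinf q (RtoC q) * (2 * CI (aw q a b c d) 0 PI *
     (qpinf q (a * b) * qpinf q (a * c) * qpinf q (a * d) * qpinf q (b * c) * qpinf q (b * d) *
      qpinf q (c * d))))%C.
  - field.
  - rewrite H. transitivity (/ RtoC 2 * qpinf q (a * b * c * d) * (I0 * qpinf q (RtoC q)))%C; [ring|].
    rewrite H0, !RtoC_mult. replace (RtoC 4) with (RtoC 2 * RtoC 2)%C by (rewrite <- RtoC_mult; f_equal; ring).
    field.
Qed.

(** * The q-Gauss sum *)

Definition gauss_term (q : R) (A B z : C) (n : nat) : C :=
  (qp q A n * qp q B n * z ^ n / (qp q (RtoC q) n * qp q (A * B * z) n))%C.

Lemma Cmod_div_le x y K m : 0 < m -> Cmod x <= K -> m <= Cmod y -> Cmod (x / y) <= K / m.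
Proof.
  intros Hm Hx Hy. assert (y <> RtoC 0) by (apply Cmod_gt_0; lra).
  rewrite Cmod_div by auto. unfold Rdiv. apply Rmult_le_compat; auto using Cmod_ge_0.
  - left; apply Rinv_0_lt_compat; lra.
  - apply Rinv_le_contravar; auto.
Qed.

Lemma qp_lower q a : 0 < q < 1 -> Cmod a < 1 -> exists m, 0 < m /\
  forall b n, Cmod b <= Cmod a -> m <= Cmod (qp q b n).
Proof.
  intros Hq Ha. eexists. split; [apply exp_pos|]. intros b n Hb. apply (qp_ge q b n (Cmod a)); auto.
Qed.

(** One [K] serves all [|w| <= |z|], because the sum is later followed along [q^n z]; the
    denominators stay controlled since [|A B w| <= |A B z| < 1]. *)
Lemma gauss_term_bound q A B z : 0 < q < 1 -> Cmod (A * B * z) < 1 ->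
  exists K, 0 <= K /\ forall w n, Cmod w <= Cmod z -> Cmod (gauss_term q A B w n) <= K * Cmod w ^ n.
Proof.
  intros Hq HC.
  destruct (qp_lower q (RtoC q) Hq) as [m1 [P1 H1]]; [rewrite Cmod_R, Rabs_pos_eq; lra|].
  destruct (qp_lower q _ Hq HC) as [m2 [P2 H2]].
  set (K := exp (Cmod A / (1 - q)) * exp (Cmod B / (1 - q))).
  assert (HK : 0 < K) by (apply Rmult_lt_0_compat; apply exp_pos).
  exists (K / (m1 * m2)). split.
  { left. apply Rdiv_lt_0_compat; auto. apply Rmult_lt_0_compat; auto. }
  intros w n Hw. unfold gauss_term.
  replace (K / (m1 * m2) * Cmod w ^ n) with (K * Cmod w ^ n / (m1 * m2)) by (field; lra).
  apply Cmod_div_le.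
  - apply Rmult_lt_0_compat; auto.
  - rewrite !Cmod_mult, Cmod_pow. apply Rmult_le_compat_r; [apply pow_le, Cmod_ge_0|].
    apply Rmult_le_compat; auto using Cmod_ge_0; apply qp_le; auto; lra.
  - rewrite Cmod_mult. apply Rmult_le_compat; try lra.
    + apply H1; lra.
    + apply H2. rewrite !(Cmod_mult (A * B)). apply Rmult_le_compat_l; auto using Cmod_ge_0.
Qed.

Lemma csum_geom_step f K r n : (forall n, Cmod (f n) <= K * r ^ n) ->
  Cmod (csum f (S n) - csum f n)%C <= K * r ^ n.
Proof.
  intros H. simpl. replace (csum f n + f n - csum f n)%C with (f n) by ring. apply H.
Qed.

Definition gauss_sum (q : R) (A B z : C) : C := clim (csum (gauss_term q A B z)).

(** The ratio [(1 + x) / 2] lies strictly between 0 and 1 even for [x = 0], as the geometric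
    estimates demand. *)
Lemma pow_le_pow_mid x n : 0 <= x < 1 -> x ^ n <= ((1 + x) / 2) ^ n.
Proof. intros Hx. apply pow_incr. lra. Qed.

Lemma ccv_gauss_sum q A B z : 0 < q < 1 -> Cmod (A * B * z) < 1 -> Cmod z < 1 ->
  ccv (csum (gauss_term q A B z)) (gauss_sum q A B z).
Proof.
  intros Hq HC Hz. pose proof (Cmod_ge_0 z).
  destruct (gauss_term_bound q A B z Hq HC) as [K [HK HB]].
  apply (ccv_geom_cauchy _ K ((1 + Cmod z) / 2)); [lra|].
  intros n. apply csum_geom_step. clear n. intros n.
  eapply Rle_trans; [apply HB; lra|]. apply Rmult_le_compat_l; auto. apply pow_le_pow_mid; lra.
Qed.

Lemma one_minus_qpow_neq0 q a n : 0 < q < 1 -> Cmod a < 1 -> (1 - RtoC (q ^ n) * a)%C <> RtoC 0.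
Proof. intros Hq Ha. apply one_minus_neq0, Cmod_qpow_mult_lt1; auto. Qed.

(* The summand of [(1-z)(1-ABz) S(z) - (1-Az)(1-Bz) S(qz)] telescopes. *)
Lemma gauss_telescope q A B z n : 0 < q < 1 -> Cmod (A * B * z) < 1 ->
  ((1 - z) * (1 - A * B * z) * csum (gauss_term q A B z) n
   - (1 - A * z) * (1 - B * z) * csum (gauss_term q A B (RtoC q * z)) n)%C =
  (- ((1 - A * B * z) * (1 - RtoC (q ^ n)) * gauss_term q A B z n))%C.
Proof.
  intros Hq HC. assert (Hq1 : Cmod (RtoC q) < 1) by (rewrite Cmod_R, Rabs_pos_eq; lra).
  assert (HCq : Cmod (RtoC q * (A * B * z)) < 1) by (apply Cmod_qmult_lt1; auto).
  induction n as [|n IH].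
  - simpl. ring.
  - set (Q := RtoC (q ^ n)).
    assert (Hn1 := qp_neq0 q (RtoC q) n Hq Hq1).
    assert (Hn2 := qp_neq0 q (A * B * z) n Hq HC).
    assert (Hn3 := one_minus_qpow_neq0 q (RtoC q) n Hq Hq1).
    assert (Hn4 := one_minus_qpow_neq0 q (A * B * z) n Hq HC).
    assert (Hn5 := one_minus_neq0 _ HC).
    assert (Hn6 := qp_neq0 q (RtoC q * (A * B * z)) n Hq HCq).
    fold Q in Hn3, Hn4.
    (* [T1] keeps the factor [1 - q^(n+1)], with which the next term enters the telescoped right
       side. *)
    assert (T1 : ((1 - Q * RtoC q) * gauss_term q A B z (S n))%C =
      (gauss_term q A B z n * z * (1 - Q * A) * (1 - Q * B) / (1 - Q * (A * B * z)))%C).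
    { unfold gauss_term. simpl. fold Q. field. auto. }
    assert (T2 : gauss_term q A B (RtoC q * z) n =
      (gauss_term q A B z n * Q * (1 - A * B * z) / (1 - Q * (A * B * z)))%C).
    { assert (Ec : (qp q (A * B * z) n * (1 - Q * (A * B * z)))%C =
                   ((1 - A * B * z) * qp q (RtoC q * (A * B * z)) n)%C).
      { change (qp q (A * B * z) n * (1 - Q * (A * B * z)))%C with (qp q (A * B * z) (1 + n)).
        rewrite qp_add. simpl. rewrite Rmult_1_r. ring. }
      unfold gauss_term.
      replace (A * B * (RtoC q * z))%C with (RtoC q * (A * B * z))%C by ring.
      replace (qp q (RtoC q * (A * B * z)) n) with
        (qp q (A * B * z) n * (1 - Q * (A * B * z)) / (1 - A * B * z))%C
        by (rewrite Ec; field; auto).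
      rewrite Cpow_mult_l, <- RtoC_pow. fold Q. field. auto. }
    simpl csum. rewrite T2.
    replace (RtoC (q ^ S n)) with (Q * RtoC q)%C by (unfold Q; simpl; rewrite RtoC_mult; ring).
    transitivity (((1 - z) * (1 - A * B * z) * csum (gauss_term q A B z) n
         - (1 - A * z) * (1 - B * z) * csum (gauss_term q A B (RtoC q * z)) n)
      + (1 - A * B * z) * gauss_term q A B z n *
        ((1 - z) - (1 - A * z) * (1 - B * z) * Q / (1 - Q * (A * B * z))))%C.
    { field. auto. }
    rewrite IH. fold Q.
    transitivity (- ((1 - A * B * z) * ((1 - Q * RtoC q) * gauss_term q A B z (S n))))%C; [|ring].
    rewrite T1. field. auto.
Qed.

(** The limit of [gauss_telescope]: its right side is bounded by a constant times [|z|^n]. *)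
Lemma gauss_sum_step q A B z : 0 < q < 1 -> Cmod (A * B * z) < 1 -> Cmod z < 1 ->
  ((1 - z) * (1 - A * B * z) * gauss_sum q A B z)%C =
  ((1 - A * z) * (1 - B * z) * gauss_sum q A B (RtoC q * z))%C.
Proof.
  intros Hq HC Hz. pose proof (Cmod_ge_0 z).
  assert (HC' : Cmod (A * B * (RtoC q * z)) < 1).
  { replace (A * B * (RtoC q * z))%C with (RtoC q * (A * B * z))%C by ring.
    apply Cmod_qmult_lt1; auto. }
  assert (L1 := ccv_gauss_sum q A B z Hq HC Hz).
  assert (L2 := ccv_gauss_sum q A B (RtoC q * z) Hq HC' (Cmod_qmult_lt1 q z Hq Hz)).
  assert (L3 : ccv (fun n => - ((1 - A * B * z) * (1 - RtoC (q ^ n)) * gauss_term q A B z n))%C (RtoC 0)).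
  { destruct (gauss_term_bound q A B z Hq HC) as [K [HK HB]].
    apply (ccv_squeeze _ _ (fun n => (Cmod (1 - A * B * z) * 2 * K) * Cmod z ^ n));
      [|apply is_lim_seq_geom_scal; lra].
    intros n. match goal with |- Cmod (- ?x - RtoC 0)%C <= _ => replace (- x - 0)%C with (- x)%C by ring end.
    rewrite Cmod_opp, !Cmod_mult.
    specialize (HB z n ltac:(lra)).
    assert (Cmod (1 - RtoC (q ^ n)) <= 2).
    { eapply Rle_trans; [apply Cmod_triangle|]. destruct (pow_unit_interval q n Hq).
      rewrite Cmod_1, Cmod_opp, Cmod_R, Rabs_pos_eq; lra. }
    rewrite !Rmult_assoc. apply Rmult_le_compat_l; [apply Cmod_ge_0|].
    apply Rmult_le_compat; auto using Cmod_ge_0. }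
  assert (L4 := ccv_plus _ _ _ _ L3 (ccv_mult _ _ _ _
     (ccv_const ((1 - A * z) * (1 - B * z))%C) L2)).
  assert (L5 := ccv_mult _ _ _ _ (ccv_const ((1 - z) * (1 - A * B * z))%C) L1).
  eapply ccv_unique; [exact L5|]. rewrite Cplus_0_l in L4.
  eapply ccv_ext; [|exact L4]. intros n. simpl. rewrite <- gauss_telescope by auto. ring.
Qed.

Lemma gauss_sum_iter q A B z n : 0 < q < 1 -> Cmod (A * B * z) < 1 -> Cmod z < 1 ->
  (qp q z n * qp q (A * B * z) n * gauss_sum q A B z)%C =
  (qp q (A * z) n * qp q (B * z) n * gauss_sum q A B (RtoC (q ^ n) * z))%C.
Proof.
  intros Hq HC Hz. induction n as [|n IH].
  - simpl. rewrite !Cmult_1_l. reflexivity.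
  - simpl qp.
    assert (Hs := gauss_sum_step q A B (RtoC (q ^ n) * z) Hq).
    replace (A * B * (RtoC (q ^ n) * z))%C with (RtoC (q ^ n) * (A * B * z))%C in Hs by ring.
    specialize (Hs (Cmod_qpow_mult_lt1 q _ n Hq HC) (Cmod_qpow_mult_lt1 q _ n Hq Hz)).
    replace (RtoC (q ^ S n) * z)%C with (RtoC q * (RtoC (q ^ n) * z))%C
      by (simpl; rewrite RtoC_mult; ring).
    transitivity ((1 - RtoC (q ^ n) * z) * (1 - RtoC (q ^ n) * (A * B * z)) *
      (qp q z n * qp q (A * B * z) n * gauss_sum q A B z))%C; [ring|].
    rewrite IH.
    transitivity (qp q (A * z) n * qp q (B * z) n * ((1 - RtoC (q ^ n) * z) *
      (1 - RtoC (q ^ n) * (A * B * z)) * gauss_sum q A B (RtoC (q ^ n) * z)))%C; [ring|].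
    rewrite Hs. ring.
Qed.

(** The term of index 0 is 1 and all later terms carry a factor [|w| = q^n |z|], so the sum is
    within a constant times [q^n] of 1. *)
Lemma gauss_sum_near_0 q A B z : 0 < q < 1 -> Cmod (A * B * z) < 1 -> Cmod z < 1 ->
  ccv (fun n => gauss_sum q A B (RtoC (q ^ n) * z)) (RtoC 1).
Proof.
  intros Hq HC Hz. pose proof (Cmod_ge_0 z).
  destruct (gauss_term_bound q A B z Hq HC) as [K [HK HB]].
  set (rho := (1 + Cmod z) / 2).
  apply (ccv_squeeze _ _ (fun n => K * Cmod z / (1 - rho) * q ^ n));
    [|apply is_lim_seq_geom_scal; lra].
  intros n. destruct (pow_unit_interval q n Hq).
  set (w := (RtoC (q ^ n) * z)%C).
  assert (Ew : Cmod w = q ^ n * Cmod z) by (unfold w; rewrite Cmod_mult, Cmod_R, Rabs_pos_eq; lra).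
  assert (Hw : Cmod w <= Cmod z) by (rewrite Ew; nra).
  pose proof (Cmod_ge_0 w).
  assert (HCw : Cmod (A * B * w) < 1).
  { eapply Rle_lt_trans; [|exact HC]. rewrite !(Cmod_mult (A * B)).
    apply Rmult_le_compat_l; auto using Cmod_ge_0. }
  (* Starting after the first term gives [v 0 = 1] and puts the factor [Cmod w] into every
     increment. *)
  set (v := fun k => csum (gauss_term q A B w) (k + 1)).
  assert (Hv : forall k, Cmod (v (S k) - v k)%C <= K * Cmod w * rho ^ k).
  { intros k. unfold v. replace (S k + 1)%nat with (S (k + 1)) by lia.
    simpl csum. match goal with |- Cmod (?x + ?y - ?x)%C <= _ => replace (x + y - x)%C with y by ring end.
    eapply Rle_trans; [apply HB; lra|]. rewrite pow_add, pow_1, (Rmult_comm (Cmod w ^ k)), <- Rmult_assoc.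
    apply Rmult_le_compat_l; [apply Rmult_le_pos; lra|]. apply pow_incr. unfold rho; lra. }
  assert (E1 : clim v = gauss_sum q A B w).
  { apply clim_unique. apply (ccv_incr (csum (gauss_term q A B w)) _ 1).
    apply ccv_gauss_sum; auto; lra. }
  assert (Hg := geom_cauchy v _ rho ltac:(unfold rho; lra) Hv 0%nat).
  rewrite E1 in Hg.
  replace (v 0%nat) with (RtoC 1) in Hg by (unfold v, gauss_term; simpl; field).
  replace (gauss_sum q A B w - 1)%C with (- (1 - gauss_sum q A B w))%C by ring.
  rewrite Cmod_opp. eapply Rle_trans; [exact Hg|]. rewrite Ew. simpl. right. field.
  unfold rho; lra.
Qed.

Lemma q_gauss q A B z : 0 < q < 1 -> Cmod (A * B * z) < 1 -> Cmod z < 1 ->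
  (qpinf q z * qpinf q (A * B * z) * gauss_sum q A B z)%C = (qpinf q (A * z) * qpinf q (B * z))%C.
Proof.
  intros Hq HC Hz.
  apply (ccv_unique (fun n => qp q z n * qp q (A * B * z) n * gauss_sum q A B z)%C).
  - apply ccv_mult; [apply ccv_mult; apply ccv_qp; auto | apply ccv_const].
  - eapply ccv_ext; [intros n; symmetry; apply gauss_sum_iter; auto|].
    rewrite <- (Cmult_1_r (qpinf q (A * z) * qpinf q (B * z))).
    apply ccv_mult; [apply ccv_mult; apply ccv_qp; auto | apply gauss_sum_near_0; auto].
Qed.

(** * Integration of the series term by term *)

Definition phi_term (q : R) (a b c r : C) (t : R) (n : nat) : C :=
  (qp q (c * ei t) n * qp q (c * ei (- t)) n * qp q (c / r) n * (a * b * r / c) ^ n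
   / (qp q (RtoC q) n * qp q (a * c) n * qp q (b * c) n))%C.
Definition phi (q : R) (a b c r : C) (t : R) : C := clim (csum (phi_term q a b c r t)).

(** As [|c e^(it)| = |c|], the bound does not depend on [t]; the resulting uniform convergence
    justifies integrating term by term. *)
Lemma phi_term_bound q a b c r : 0 < q < 1 -> Cmod a < 1 -> Cmod b < 1 -> Cmod c < 1 ->
  exists K, 0 <= K /\ forall t n, Cmod (phi_term q a b c r t n) <= K * Cmod (a * b * r / c) ^ n.
Proof.
  intros Hq Ha Hb Hc.
  destruct (qp_lower q (RtoC q) Hq) as [m1 [P1 H1]]; [rewrite Cmod_R, Rabs_pos_eq; lra|].
  destruct (qp_lower q (a * c) Hq) as [m2 [P2 H2]]; [apply Cmod_mult_lt1; auto|].
  destruct (qp_lower q (b * c) Hq) as [m3 [P3 H3]]; [apply Cmod_mult_lt1; auto|].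
  set (e := exp (Cmod c / (1 - q))). set (K := e * e * exp (Cmod (c / r) / (1 - q))).
  assert (HK : 0 < K) by (unfold K, e; repeat apply Rmult_lt_0_compat; apply exp_pos).
  assert (Hm : 0 < m1 * m2 * m3) by (repeat apply Rmult_lt_0_compat; auto).
  exists (K / (m1 * m2 * m3)). split; [left; apply Rdiv_lt_0_compat; auto|].
  intros t n. unfold phi_term. set (z := (a * b * r / c)%C).
  replace (K / (m1 * m2 * m3) * Cmod z ^ n) with (K * Cmod z ^ n / (m1 * m2 * m3)) by (field; lra).
  apply Cmod_div_le; auto.
  - rewrite !Cmod_mult, Cmod_pow. apply Rmult_le_compat_r; [apply pow_le, Cmod_ge_0|].
    unfold K, e. repeat (apply Rmult_le_compat; try apply Rmult_le_pos; auto using Cmod_ge_0);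
      apply qp_le; auto; rewrite ?Cmod_mult_ei; lra.
  - rewrite !Cmod_mult. apply Rmult_le_compat; [nra|lra| |apply H3; lra].
    apply Rmult_le_compat; [lra|lra|apply H1; lra|apply H2; lra].
Qed.

Lemma phi_tail q a b c r : 0 < q < 1 -> Cmod a < 1 -> Cmod b < 1 -> Cmod c < 1 ->
  Cmod (a * b * r / c) < 1 -> exists K rho, 0 < rho < 1 /\
  forall t n, Cmod (csum (phi_term q a b c r t) n - phi q a b c r t)%C <= K * rho ^ n.
Proof.
  intros Hq Ha Hb Hc Hz. destruct (phi_term_bound q a b c r Hq Ha Hb Hc) as [K [HK HB]].
  pose proof (Cmod_ge_0 (a * b * r / c)).
  set (rho := (1 + Cmod (a * b * r / c)) / 2).
  exists (K / (1 - rho)), rho. split; [unfold rho; lra|]. intros t.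
  apply geom_cauchy; [unfold rho; lra|]. intros n. apply csum_geom_step. clear n. intros n.
  eapply Rle_trans; [apply HB|]. apply Rmult_le_compat_l; auto. apply pow_le_pow_mid; lra.
Qed.

Lemma ccv_phi q a b c r t : 0 < q < 1 -> Cmod a < 1 -> Cmod b < 1 -> Cmod c < 1 ->
  Cmod (a * b * r / c) < 1 -> ccv (csum (phi_term q a b c r t)) (phi q a b c r t).
Proof.
  intros Hq Ha Hb Hc Hz. destruct (phi_tail q a b c r Hq Ha Hb Hc Hz) as [K [rho [Hr H]]].
  apply (ccv_squeeze _ _ _ (H t)). apply is_lim_seq_geom_scal; lra.
Qed.

Lemma unif_cv_phi q a b c r : 0 < q < 1 -> Cmod a < 1 -> Cmod b < 1 -> Cmod c < 1 ->
  Cmod (a * b * r / c) < 1 ->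
  unif_cv (fun _ => True) (fun n t => csum (phi_term q a b c r t) n) (phi q a b c r) /\
  bounded_on (fun _ => True) (phi q a b c r).
Proof.
  intros Hq Ha Hb Hc Hz. destruct (phi_tail q a b c r Hq Ha Hb Hc Hz) as [K [rho [Hr H]]]. split.
  - intros eps He. assert (Hl := is_lim_seq_geom_scal K rho ltac:(lra)).
    apply is_lim_seq_spec in Hl. destruct (Hl (mkposreal eps He)) as [N HN].
    exists N. intros n Hn t _. specialize (HN n Hn). simpl in HN. rewrite Rminus_0_r in HN.
    eapply Rle_lt_trans; [apply H|]. eapply Rle_lt_trans; [apply Rle_abs|exact HN].
  (* At [n = 0] the partial sum is empty, so the tail estimate bounds [phi] itself. *)
  - exists K. intros t _. specialize (H t 0%nat). simpl in H.
    replace (0 - phi q a b c r t)%C with (- phi q a b c r t)%C in H by ring.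
    rewrite Cmod_opp in H. lra.
Qed.

Definition phi_coef (q : R) (a b c r : C) (n : nat) : C :=
  (qp q (c / r) n * (a * b * r / c) ^ n
   / (qp q (RtoC q) n * qp q (a * c) n * qp q (b * c) n))%C.

(* The factor [(c e^(it), c e^(-it); q)_n] of the summand turns [h(x; c)] into [h(x; c q^n)]. *)
Lemma aw_phi_term q a b c d r t n :
  0 < q < 1 -> Cmod a < 1 -> Cmod b < 1 -> Cmod c < 1 -> Cmod d < 1 ->
  (aw q a b c d t * phi_term q a b c r t n)%C =
  (phi_coef q a b c r n * aw q (RtoC (q ^ n) * c) d a b t)%C.
Proof.
  intros Hq Ha Hb Hc Hd. rewrite aw_shift, (aw_perm q a), (aw_perm q b) by auto.
  unfold phi_term, phi_coef, Cdiv. ring.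
Qed.

Lemma ccont_csum (f : nat -> R -> C) n : (forall n, ccont (f n)) -> ccont (fun t => csum (fun k => f k t) n).
Proof.
  intros H. induction n as [|n IH]; simpl; [apply ccont_const | apply ccont_plus; auto].
Qed.

Lemma CI_csum (f : nat -> R -> C) n a b : (forall n, ccont (f n)) ->
  CI (fun t => csum (fun k => f k t) n) a b = csum (fun k => CI (f k) a b) n.
Proof.
  intros H. induction n as [|n IH]; simpl.
  - rewrite (CI_ext _ (fun t => RtoC 0 * RtoC 0)%C) by (intros; ring).
    rewrite CI_scal by apply ccont_const. ring.
  - rewrite CI_plus, IH; auto using ccont_csum.
Qed.

Lemma csum_scal c f n : csum (fun k => c * f k)%C n = (c * csum f n)%C.
Proof. induction n as [|n IH]; simpl; [ring|]. rewrite IH. ring. Qed.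

Lemma csum_ext f g n : (forall k, f k = g k) -> csum f n = csum g n.
Proof. intros E. induction n as [|n IH]; simpl; [reflexivity|]. rewrite IH, E. reflexivity. Qed.

Lemma CI_aw_shift q a b c d n :
  0 < q < 1 -> Cmod a < 1 -> Cmod b < 1 -> Cmod c < 1 -> Cmod d < 1 ->
  (CI (aw q a b c d) 0 PI * (qp q (a * b) n * qp q (a * c) n * qp q (a * d) n))%C =
  (qp q (a * b * c * d) n * CI (aw q (RtoC (q ^ n) * a) b c d) 0 PI)%C.
Proof.
  intros Hq Ha Hb Hc Hd. assert (H := awI_iter q a b c d n Hq Ha Hb Hc Hd).
  assert (Han := Cmod_qpow_mult_lt1 q a n Hq Ha).
  unfold awI in H. rewrite !CI_even in H by (auto using ccont_aw, aw_even).
  transitivity (/ RtoC 2 * (2 * CI (aw q a b c d) 0 PI *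
    (qp q (a * b) n * qp q (a * c) n * qp q (a * d) n)))%C; [field|].
  rewrite H. field.
Qed.

(** Moving [c] to [c q^n] multiplies the integral by [(ca, cb, cd; q)_n / (abcd; q)_n]. The first
    two factors cancel the denominators [(ac, bc; q)_n] of the series, leaving
    [(c/r, cd; q)_n / (q, abcd; q)_n]. Continuity is recorded along with the value because it yields
    integrability. *)
Lemma CI_aw_phi q a b c d r :
  0 < q < 1 -> c <> RtoC 0 -> r <> RtoC 0 ->
  Cmod a < 1 -> Cmod b < 1 -> Cmod c < 1 -> Cmod d < 1 -> Cmod (a * b * r / c) < 1 ->
  ccont (fun t => aw q a b c d t * phi q a b c r t)%C /\
  CI (fun t => aw q a b c d t * phi q a b c r t)%C 0 PI =
  (CI (aw q a b c d) 0 PI * gauss_sum q (c / r) (c * d) (a * b * r / c))%C.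
Proof.
  intros Hq Hc0 Hr0 Ha Hb Hc Hd Hz. pose proof PI_RGT_0.
  destruct (unif_cv_phi q a b c r Hq Ha Hb Hc Hz) as [U Bp].
  set (f := fun k t => (phi_coef q a b c r k * aw q (RtoC (q ^ k) * c) d a b t)%C).
  assert (Hf : forall k, ccont (f k)).
  { intros k. apply ccont_mult; [apply ccont_const|].
    apply ccont_aw; auto. apply Cmod_qpow_mult_lt1; auto. }
  assert (Ef : forall t n, csum (fun k => f k t) n = (aw q a b c d t * csum (phi_term q a b c r t) n)%C).
  { intros t n. rewrite <- csum_scal. apply csum_ext. intros k. unfold f.
    symmetry. apply aw_phi_term; auto. }
  assert (UF : unif_cv (fun _ => True) (fun n t => csum (fun k => f k t) n)
                 (fun t => aw q a b c d t * phi q a b c r t)%C).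
  { assert (V := unif_cv_mult _ (fun _ => aw q a b c d) (aw q a b c d) _ _
      (unif_cv_const _ _) U (bounded_on_aw q a b c d Hq Ha Hb Hc Hd) Bp).
    intros eps He. destruct (V eps He) as [N HN]. exists N. intros n Hn t Ht.
    rewrite Ef. apply HN; auto. }
  assert (CF : forall n, ccont (fun t => csum (fun k => f k t) n)) by (intros; apply ccont_csum; auto).
  split; [apply (ccont_unif_cv _ _ CF UF)|].
  assert (Hz0 : (c / r * (c * d) * (a * b * r / c))%C = (c * d * a * b)%C) by (field; auto).
  assert (HC : Cmod (c * d * a * b) < 1) by (repeat apply Cmod_mult_lt1; auto).
  apply (ccv_unique (fun n => CI (fun t => csum (fun k => f k t) n) 0 PI)).
  - apply ccv_CI; auto; lra.
  - eapply ccv_ext; [|apply ccv_mult; [apply ccv_const|apply ccv_gauss_sum; auto; rewrite Hz0; auto]].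
    intros n. simpl. rewrite CI_csum, <- csum_scal by auto. apply csum_ext. intros k.
    unfold f. rewrite CI_scal by (apply ccont_aw; auto; apply Cmod_qpow_mult_lt1; auto).
    assert (Hs := CI_aw_shift q c d a b k Hq Hc Hd Ha Hb).
    (* Two rotations bring [c] to the first place, where [CI_aw_shift] acts. *)
    rewrite (CI_ext (aw q a b c d) (aw q c d a b)) by (intros; rewrite aw_perm, aw_perm; reflexivity).
    unfold gauss_term, phi_coef. rewrite Hz0.
    assert (N1 := qp_neq0 q (c * d * a * b) k Hq HC).
    assert (N2 := qp_neq0 q (a * c) k Hq (Cmod_mult_lt1 _ _ Ha Hc)).
    assert (N3 := qp_neq0 q (b * c) k Hq (Cmod_mult_lt1 _ _ Hb Hc)).
    assert (N4 : qp q (RtoC q) k <> RtoC 0) by (apply qp_neq0; auto; rewrite Cmod_R, Rabs_pos_eq; lra).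
    replace (CI (aw q (RtoC (q ^ k) * c) d a b) 0 PI) with
      (/ qp q (c * d * a * b) k * (qp q (c * d * a * b) k * CI (aw q (RtoC (q ^ k) * c) d a b) 0 PI))%C
      by (field; auto).
    rewrite <- Hs, (Cmult_comm c a), (Cmult_comm c b).
    set (z := ((a * b * r / c) ^ k)%C). set (w := qp q (c / r) k). clearbody z w.
    field. auto.
Qed.

(** For [A = c/r], [B = cd], [z = abr/c] one has [ABz = abcd], [Az = ab] and [Bz = abdr]. Gauss's
    sum thus cancels [(abcd; q)] and [(ab; q)] in the Askey-Wilson value and brings in [(abdr; q)]
    and [(abr/c; q)]. *)
Lemma CI_aw_phi_value q a b c d r :
  0 < q < 1 -> c <> RtoC 0 -> r <> RtoC 0 ->
  Cmod a < 1 -> Cmod b < 1 -> Cmod c < 1 -> Cmod d < 1 -> Cmod (a * b * r / c) < 1 ->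
  CI (fun t => aw q a b c d t * phi q a b c r t)%C 0 PI =
  (RtoC (2 * PI) * qpinf q (a * b * d * r) /
   (qpinf q (RtoC q) * qpinf q (a * c) * qpinf q (a * d) * qpinf q (b * c) * qpinf q (b * d)
    * qpinf q (c * d) * qpinf q (a * b * r / c)))%C.
Proof.
  intros Hq Hc0 Hr0 Ha Hb Hc Hd Hz.
  destruct (CI_aw_phi q a b c d r Hq Hc0 Hr0 Ha Hb Hc Hd Hz) as [_ E]. rewrite E. clear E.
  assert (Hz0 : (c / r * (c * d) * (a * b * r / c))%C = (a * b * c * d)%C) by (field; auto).
  assert (HC : Cmod (a * b * c * d) < 1) by (repeat apply Cmod_mult_lt1; auto).
  assert (G := q_gauss q (c / r) (c * d) (a * b * r / c) Hq). rewrite Hz0 in G.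
  specialize (G HC Hz).
  replace (c / r * (a * b * r / c))%C with (a * b)%C in G by (field; auto).
  replace (c * d * (a * b * r / c))%C with (a * b * d * r)%C in G by (field; auto).
  assert (W := askey_wilson q a b c d Hq Ha Hb Hc Hd).
  assert (Nz : forall x, Cmod x < 1 -> qpinf q x <> RtoC 0) by (intros; apply qpinf_neq0; auto).
  assert (N1 := Nz _ (Cmod_mult_lt1 _ _ Ha Hb)). assert (N2 := Nz _ (Cmod_mult_lt1 _ _ Ha Hc)).
  assert (N3 := Nz _ (Cmod_mult_lt1 _ _ Ha Hd)). assert (N4 := Nz _ (Cmod_mult_lt1 _ _ Hb Hc)).
  assert (N5 := Nz _ (Cmod_mult_lt1 _ _ Hb Hd)). assert (N6 := Nz _ (Cmod_mult_lt1 _ _ Hc Hd)).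
  assert (N7 := Nz _ HC). assert (N8 := Nz _ Hz).
  assert (N9 : qpinf q (RtoC q) <> RtoC 0) by (apply Nz; rewrite Cmod_R, Rabs_pos_eq; lra).
  set (z := (a * b * r / c)%C) in *. clearbody z.
  set (S := gauss_sum q (c / r) (c * d) z) in *. set (J := CI (aw q a b c d) 0 PI) in *.
  clearbody S J.
  replace J with (RtoC (2 * PI) * qpinf q (a * b * c * d) /
    (qpinf q (RtoC q) * qpinf q (a * b) * qpinf q (a * c) * qpinf q (a * d)
     * qpinf q (b * c) * qpinf q (b * d) * qpinf q (c * d)))%C
    by (rewrite <- W; field; repeat split; auto).
  replace S with (qpinf q (a * b) * qpinf q (a * b * d * r) / (qpinf q z * qpinf q (a * b * c * d)))%C
    by (rewrite <- G; field; repeat split; auto).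
  field. repeat split; auto.
Qed.

(** * Transfer to the type [Cplx] *)

Definition toC (z : Cplx) : C := (Defs.Re z, Defs.Im z).
Definition ofC (z : C) : Cplx := mkC (fst z) (snd z).

Lemma ofC_toC z : ofC (toC z) = z.
Proof. destruct z; reflexivity. Qed.

Lemma toC_RtoC x : toC (Defs.RtoC x) = RtoC x.
Proof. reflexivity. Qed.

Lemma toC_mul z w : toC (Cmul z w) = (toC z * toC w)%C.
Proof. reflexivity. Qed.

Lemma toC_add z w : toC (Cadd z w) = (toC z + toC w)%C.
Proof. reflexivity. Qed.

Lemma toC_sub z w : toC (Csub z w) = (toC z - toC w)%C.
Proof. reflexivity. Qed.

Lemma toC_scal x z : toC (Cscal x z) = (RtoC x * toC z)%C.
Proof. apply injective_projections; simpl; ring. Qed.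

Lemma toC_div z w : toC (Defs.Cdiv z w) = (toC z / toC w)%C.
Proof.
  unfold Defs.Cdiv. rewrite toC_mul. unfold Cdiv. f_equal.
  unfold toC, Defs.Cinv, Cinv; simpl. rewrite !Rmult_1_r. reflexivity.
Qed.

Lemma toC_pow z n : toC (Defs.Cpow z n) = (toC z ^ n)%C.
Proof. induction n as [|n IH]; simpl; [reflexivity|]. rewrite toC_mul, IH. reflexivity. Qed.

Lemma toC_Cexpi t : toC (Cexpi t) = ei t.
Proof. reflexivity. Qed.

Lemma Cnorm_toC z : Cnorm z = Cmod (toC z).
Proof. unfold Cnorm, Cmod, toC; simpl. rewrite !Rmult_1_r. reflexivity. Qed.

Lemma toC_neq0 z : z <> Czero -> toC z <> RtoC 0.
Proof. intros H E. apply H. rewrite <- (ofC_toC z), E. reflexivity. Qed.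

Lemma toC_qpoch q a n : toC (qpoch a q n) = qp q (toC a) n.
Proof.
  induction n as [|n IH]; [reflexivity|]. simpl.
  rewrite toC_mul, toC_sub, toC_scal, IH. reflexivity.
Qed.

(** [Clim] is an [epsilon] choice: existence of a limit makes the chosen value a limit, and
    uniqueness identifies it. *)
Lemma toC_Clim u l : ccv (fun n => toC (u n)) l -> toC (Clim u) = l.
Proof.
  intros H. destruct (ccv_is_lim_seq _ _ H) as [H1 H2].
  apply is_lim_seq_Reals in H1, H2.
  assert (Hs : Cseq_cv u (Clim u)).
  { unfold Clim. apply epsilon_spec. exists (ofC l). split; assumption. }
  destruct Hs as [H3 H4]. apply injective_projections.
  - apply (UL_sequence _ _ _ H3 H1).
  - apply (UL_sequence _ _ _ H4 H2).
Qed.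

Lemma toC_qpoch_inf q a : 0 < q < 1 -> toC (qpoch_inf a q) = qpinf q (toC a).
Proof.
  intros Hq. apply toC_Clim. eapply ccv_ext; [|apply ccv_qp; auto].
  intros n. symmetry. apply toC_qpoch.
Qed.

(** Each quadratic factor splits as [(1 - q^k a e^(it)) (1 - q^k a e^(-it))], by
    [2 cos t = e^(it) + e^(-it)] and [e^(it) e^(-it) = 1]. *)
Lemma toC_h q a t : 0 < q < 1 -> toC (h (cos t) a q) = hinf q (toC a) t.
Proof.
  intros Hq. apply toC_Clim.
  apply (ccv_ext (fun n => qp q (toC a * ei t) n * qp q (toC a * ei (- t)) n)%C).
  - induction n as [|n IH]; [simpl; apply Cmult_1_l|].
    simpl h_part. rewrite toC_mul, <- IH, toC_add, toC_sub, !toC_scal, toC_mul.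
    replace (RtoC (2 * q ^ n * cos t)) with (RtoC (q ^ n) * (ei t + ei (- t)))%C.
    + replace (n + (n + 0))%nat with (n + n)%nat by lia. rewrite pow_add, RtoC_mult.
      change (toC Cone) with (RtoC 1).
      transitivity (qp q (toC a * ei t) n * qp q (toC a * ei (- t)) n *
        (1 - RtoC (q ^ n) * (ei t + ei (- t)) * toC a
         + RtoC (q ^ n) * RtoC (q ^ n) * (toC a * toC a) * (ei t * ei (- t))))%C.
      * simpl. ring.
      * rewrite <- ei_plus, Rplus_opp_r, ei_0. ring.
    + unfold ei. rewrite cos_neg, sin_neg. apply injective_projections; simpl; ring.
  - apply ccv_mult; apply ccv_qp; auto.
Qed.

Lemma toC_phi32_part a1 a2 a3 b1 b2 q z n :
  toC (phi32_part a1 a2 a3 b1 b2 q z n) = csum (fun k => toC (phi32_term a1 a2 a3 b1 b2 q z k)) n.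
Proof. induction n as [|n IH]; simpl; [reflexivity|]. rewrite toC_add, IH. reflexivity. Qed.

(** [RInt_Reals] holds for every integrability witness, hence for the chosen one; the default value
    0 is excluded by existence. *)
Lemma RInt_Defs f a b : ex_RInt f a b -> Defs.RInt f a b = RInt f a b.
Proof.
  intros H. unfold Defs.RInt. destruct (excluded_middle_informative _) as [Hi|Hi].
  - symmetry. apply RInt_Reals.
  - exfalso. apply Hi. constructor. apply ex_RInt_Reals_0, H.
Qed.

Lemma C_integrable_ccont F a b : ccont (fun t => toC (F t)) ->
  C_integrable F a b /\ toC (CInt F a b) = CI (fun t => toC (F t)) a b.
Proof.
  intros H. destruct (ccont_ex_RInt _ a b H) as [H1 H2]. split.
  - split; constructor; apply ex_RInt_Reals_0; assumption.
  - apply injective_projections; apply RInt_Defs; assumption.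
Qed.

Lemma toC_inj z w : toC z = toC w -> z = w.
Proof. intros E. rewrite <- (ofC_toC z), <- (ofC_toC w), E. reflexivity. Qed.

Lemma toC_h_double t q : 0 < q < 1 ->
  toC (h (cos (2 * t)) Cone q) = (qpinf q (ei (2 * t)) * qpinf q (ei (- (2 * t))))%C.
Proof.
  intros Hq. rewrite toC_h by auto. unfold hinf.
  change (toC Cone) with (RtoC 1). rewrite !Cmult_1_l. reflexivity.
Qed.

Lemma toC_phi32 q a b c r t : 0 < q < 1 ->
  Cnorm a < 1 -> Cnorm b < 1 -> Cnorm c < 1 -> Cnorm (Defs.Cdiv (Cmul (Cmul a b) r) c) < 1 ->
  toC (phi32 (Cmul c (Cexpi t)) (Cmul c (Cexpi (- t))) (Defs.Cdiv c r)
             (Cmul a c) (Cmul b c) q (Defs.Cdiv (Cmul (Cmul a b) r) c)) =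
  phi q (toC a) (toC b) (toC c) (toC r) t.
Proof.
  intros Hq Ha Hb Hc Hz. rewrite !Cnorm_toC, ?toC_div, ?toC_mul in *. apply toC_Clim.
  eapply ccv_ext; [|apply ccv_phi; auto]. intros n. rewrite toC_phi32_part.
  apply csum_ext. intros k. unfold phi32_term, phi_term.
  rewrite toC_div, !toC_mul, !toC_qpoch, !toC_mul, !toC_pow, !toC_div, !toC_mul, !toC_Cexpi, toC_RtoC.
  reflexivity.
Qed.

End AskeyWilson.

Import AskeyWilson.

Theorem mainTheorem8 (q : R) (a b c d r : Cplx) :
  0 < q < 1 -> c <> Czero -> r <> Czero ->
  Cnorm a < 1 -> Cnorm b < 1 -> Cnorm c < 1 -> Cnorm d < 1 ->
  Cnorm (Cdiv (Cmul (Cmul a b) r) c) < 1 ->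
  let F := fun t : R =>
    Cmul
      (Cdiv (h (cos (2 * t)) Cone q)
            (Cmul (Cmul (Cmul (h (cos t) a q) (h (cos t) b q)) (h (cos t) c q))
                  (h (cos t) d q)))
      (phi32 (Cmul c (Cexpi t)) (Cmul c (Cexpi (- t))) (Cdiv c r)
             (Cmul a c) (Cmul b c) q (Cdiv (Cmul (Cmul a b) r) c)) in
  C_integrable F 0 PI /\
  CInt F 0 PI =
    Cdiv (Cscal (2 * PI) (qpoch_inf (Cmul (Cmul (Cmul a b) d) r) q))
         (Cmul (Cmul (Cmul (Cmul (Cmul (Cmul
            (qpoch_inf (RtoC q) q) (qpoch_inf (Cmul a c) q))
            (qpoch_inf (Cmul a d) q)) (qpoch_inf (Cmul b c) q))
            (qpoch_inf (Cmul b d) q)) (qpoch_inf (Cmul c d) q))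
            (qpoch_inf (Cdiv (Cmul (Cmul a b) r) c) q)).
Proof.
  intros Hq Hc0 Hr0 Ha Hb Hc Hd Hz F.
  (* In this orientation [EF] transports continuity through [ccont_ext] and the value through
     [CI_ext]. *)
  assert (EF : forall t, Coquelicot.Complex.Cmult (aw q (toC a) (toC b) (toC c) (toC d) t)
                           (phi q (toC a) (toC b) (toC c) (toC r) t) = toC (F t)).
  { intros t. unfold F.
    rewrite toC_mul, toC_div, !toC_mul, toC_phi32, toC_h_double, !toC_h by auto. reflexivity. }
  apply toC_neq0 in Hc0, Hr0. rewrite Cnorm_toC in Ha, Hb, Hc, Hd, Hz.
  rewrite toC_div, !toC_mul in Hz.
  destruct (CI_aw_phi q _ _ _ _ _ Hq Hc0 Hr0 Ha Hb Hc Hd Hz) as [Hcont _].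
  destruct (C_integrable_ccont F 0 PI (ccont_ext _ _ EF Hcont)) as [HI HV].
  split; [exact HI|]. apply toC_inj. rewrite HV, <- (CI_ext _ _ 0 PI EF).
  rewrite CI_aw_phi_value by assumption.
  rewrite toC_div, toC_scal, !toC_mul, !toC_qpoch_inf, !toC_mul, toC_div, !toC_mul by auto.
  reflexivity.
Qed.
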